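(* Let $A$ be an analytic function in $\mathbb{D}$ with $\|A\|_{\mathcal{L}^1}<\infty$. If $f$ is an analytic solution in $\mathbb{D}$ of the differential equation $f''+Af=0$ which satisfies $$V_f=\sup_{z\in\mathbb{C}}\int_{D(z,1)}n(f,\zeta)\,dm(\zeta)<\infty,$$ then $$\int_{\mathbb{D}}|f'(z)|^2\left(\log\frac{e}{1-|z|}\right)^{-\beta}dm(z)<\infty$$ for any $\beta$ with $\|A\|_{\mathcal{L}^1}/2<\beta<\infty$.
   Context: $\mathbb{D}=\{z\in\mathbb{C}:|z|<1\}$ is the open unit disc. For $A$ analytic in $\mathbb{D}$, $$\|A\|_{\mathcal{L}^1}=\sup_{z\in\mathbb{D}}|A(z)|(1-|z|^2)^2\log\frac{e}{1-|z|}.$$ For $f$ analytic in $\mathbb{D}$ and $\zeta\in\mathbb{C}$, $n(f,\zeta)=\#\{z\in\mathbb{D}:f(z)=\zeta\}\in\{0,1,2,\dots\}\cup\{\infty\}$ is the counting function of $\zeta$-points. $D(z,r)$ is the Euclidean disc of radius $r>0$ centered at $z\in\mathbb{C}$, and $dm$ is the Lebesgue area measure. *)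

(* Defs.v *)
From HB Require Import structures.
From mathcomp Require Import all_boot all_order all_algebra.
From mathcomp Require Import all_classical all_reals all_analysis.
From mathcomp Require Export complex.

Set Implicit Arguments.
Unset Strict Implicit.
Unset Printing Implicit Defensive.

Import Order.TTheory GRing.Theory Num.Theory.
Import numFieldNormedType.Exports.
Import ComplexField.Normc.

Local Open Scope classical_set_scope.
Local Open Scope ring_scope.
Local Open Scope complex_scope.

(* The norm `|z| of z : R[i] lives in R[i]; normc z is the same modulus as an
   element of R. *)
Definition disc (R : realType) (c : R[i]) (r : R) : set R[i] :=
  [set z | normc (z - c) < r].

Definition unit_disc (R : realType) : set R[i] := [set z | normc z < 1].

(* R[i]^o is R[i] as a normed module over the field R[i], so differentiability
   and derivatives are the complex ones. *)
Definition cderivable (R : realType) (f : R[i] -> R[i]) (z : R[i]) : Prop :=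
  derivable (f : R[i]^o -> R[i]^o) z 1.

Definition cderiv (R : realType) (f : R[i] -> R[i]) : R[i] -> R[i] :=
  derive1 (f : R[i] -> R[i]^o).

Definition analytic (R : realType) (U : set R[i]) (f : R[i] -> R[i]) : Prop :=
  forall z, U z -> cderivable f z.

(* Derivatives are total functions, so the existence of f'' is made part of
   what the equation f'' + A f = 0 asserts; for f analytic on an open U it is
   automatic. *)
Definition solves_ode (R : realType) (U : set R[i]) (A f : R[i] -> R[i]) : Prop :=
  forall z, U z ->
    cderivable (cderiv f) z /\ cderiv (cderiv f) z + A z * f z = 0.

Definition log_weight (R : realType) (z : R[i]) : R :=
  ln (expR 1 / (1 - normc z)).

Definition normL1 (R : realType) (A : R[i] -> R[i]) : \bar R :=
  ereal_sup [set (normc (A z) * (1 - normc z ^+ 2) ^+ 2 * log_weight z)%:E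
            | z in @unit_disc R].

(* Distinct points are counted, without multiplicity; counting is +oo on
   infinite sets. *)
Definition npoints (R : realType) (f : R[i] -> R[i]) (w : R[i]) : \bar R :=
  counting [set z | unit_disc z /\ f z = w].

(* R[i] carries no measurable structure in the library: area integrals are
   taken over R * R, the pair (x, y) standing for x +i* y. *)
Definition area_integral (R : realType) (D : set R[i]) (F : R[i] -> \bar R)
    : \bar R :=
  (\int[(@lebesgue_measure R \x @lebesgue_measure R)%E]_(p in
      [set p : R * R | D (p.1 +i* p.2)]) F (p.1 +i* p.2))%E.

Definition Vsup (R : realType) (f : R[i] -> R[i]) : \bar R :=
  ereal_sup [set area_integral (disc z 1) (npoints f) | z in [set: R[i]]].

(* Main.v *)
Require Import Defs.
From HB Require Import structures.
From mathcomp Require Import all_boot all_order all_algebra.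
From mathcomp Require Import all_classical all_reals all_analysis.
From mathcomp Require Import measurable_realfun.
From mathcomp Require Import ring lra.
Import Order.TTheory GRing.Theory Num.Theory.
Import numFieldNormedType.Exports.
Import ComplexField.Normc.
Set Implicit Arguments.
Unset Strict Implicit.
Unset Printing Implicit Defensive.
Local Open Scope classical_set_scope.
Local Open Scope ring_scope.
Local Open Scope complex_scope.

Local Notation Re := complex.Re.
Local Notation Im := complex.Im.

(** Write [L t = 1 - ln (1 - t)] for the logarithmic weight and [alpha] for the
    norm of [A]. The theorem combines a growth estimate for [f] with an area
    count.

    Growth. On a radius, [g s = f (s zeta)] satisfies [|g''| <= a |g|] with
    [a = alpha / ((1 - s^2)^2 L)]. Since [(1 - s^2)^2] is asymptotic to
    [4 (1 - s)^2], the function [L^c] is a supersolution of [y'' = a y] near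
    the circle as soon as [4 c > alpha]; the factor [exp (m s)] makes
    [K L^c exp (m s)] one on the whole radius ([log_majorant_ineq]). Comparing
    [g] with it ([ode_comparison]) gives [|f z| <= K' L(|z|)^c]
    ([ode_growth]). As [beta > alpha / 2], one can take [c] with
    [alpha < 4 c] and [2 c < beta].

    Area. If [|f| <= M] on [|z| <= r], then the integral of [|f'|^2] over
    [|z| < r] is at most a constant times the integral of the number of
    preimages over the square of half-side [M + 1] ([area_inequality]). The
    sharp form of this inequality is a change of variables; up to a constant
    it follows from a bisection. If the inequality, with an extra term [eps]
    times the area, failed on a square, it would fail on one of its quarters,
    hence on arbitrarily small squares around some point. There it holds: if
    [f'] vanishes at the point, the extra term suffices, and otherwise the
    image of a small square contains a square of comparable size
    ([image_square]). Covering the target square by unit discs bounds its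
    integral by a constant times [M^2 V_f] ([integral_npoints_large_square]).

    Summation. On the annulus where [2^k <= L < 2^(k+1)] the weight
    [L^(-beta)] is at most [2^(-k beta)] and [M] can be taken of order
    [2^(k c)], so that its contribution is at most a constant times
    [2^(k (2 c - beta))], the term of a convergent geometric series.

    The counting function is not known to be measurable, so the integral of a
    nonnegative function is used throughout as the supremum of the integrals
    of the simple functions below it. This lower integral is superadditive in
    the integrand and countably subadditive in the domain, and these two
    inequalities point in the directions that the argument needs. *)

(** * Integrals of nonnegative functions without measurability *)

Section lower_integral.
Local Open Scope ereal_scope.
Context d (T : measurableType d) (R : realType) (mu : {measure set T -> \bar R}).
Implicit Types (f g : T -> \bar R) (D : set T).
Import HBNNSimple.

Lemma le_lower_integral D f g : (forall x, D x -> 0 <= f x) ->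
  (forall x, D x -> f x <= g x) ->
  \int[mu]_(x in D) f x <= \int[mu]_(x in D) g x.
Proof.
move=> f0 fg; rewrite !ge0_integralE//; last first.
  by move=> x Dx; exact: le_trans (f0 _ Dx) (fg _ Dx).
apply: ereal_sup_le => _ [h /= hf <-]; exists h => //= x.
apply: le_trans (hf x) _; rewrite /patch; case: ifP => // /set_mem; exact: fg.
Qed.

Lemma lower_integral_subset D D' f : D `<=` D' -> (forall x, D' x -> 0 <= f x) ->
  \int[mu]_(x in D) f x <= \int[mu]_(x in D') f x.
Proof.
move=> sD f0; rewrite integral_mkcond [leRHS]integral_mkcond.
apply: le_lower_integral => x _; rewrite /patch.
  by case: ifP => // /set_mem /sD /f0.
case: ifPn => [/set_mem /sD Dx|_]; first by rewrite mem_set.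
by case: ifPn => // /set_mem /f0.
Qed.

(** Either [c] is infinite, or it bounds all the terms by finite numbers, and
    then one term at a time can be moved to the other side. *)
Lemma ereal_sup_add_le (A B : set (\bar R)) (c : \bar R) :
  A 0 -> B 0 -> (forall a b, A a -> B b -> a + b <= c) ->
  (forall a, A a -> 0 <= a) -> (forall b, B b -> 0 <= b) ->
  ereal_sup A + ereal_sup B <= c.
Proof.
move=> A0 B0 ABc Age0 Bge0.
have c0 : 0 <= c by rewrite -(adde0 0); exact: ABc.
case: (eqVneq c +oo) => [->|cNoo]; first by rewrite leey.
have cfin : c \is a fin_num by rewrite ge0_fin_numE// ltey.
have bfin b : B b -> b \is a fin_num.
  move=> Bb; rewrite ge0_fin_numE; last exact: Bge0.
  by rewrite (@le_lt_trans _ _ c) ?ltey// -(add0e b); exact: ABc.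
have sAle b : B b -> ereal_sup A <= c - b.
  move=> Bb; apply: ge_ereal_sup => a Aa.
  by rewrite leeBrDr; [exact: ABc|exact: bfin].
have sA0 : 0 <= ereal_sup A by exact: ereal_sup_ubound.
have sAfin : ereal_sup A \is a fin_num.
  rewrite ge0_fin_numE// (@le_lt_trans _ _ c) ?ltey//.
  by have := sAle _ B0; rewrite sube0.
rewrite addeC -leeBrDr//; apply: ge_ereal_sup => b Bb.
by rewrite leeBrDr// addeC -leeBrDr ?bfin//; exact: sAle.
Qed.

Lemma lower_integralD D f g : (forall x, D x -> 0 <= f x) ->
  (forall x, D x -> 0 <= g x) ->
  \int[mu]_(x in D) f x + \int[mu]_(x in D) g x
    <= \int[mu]_(x in D) (f x + g x).
Proof.
move=> f0 g0; rewrite [leRHS]ge0_integralE//; last first.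
  by move=> x Dx; rewrite adde_ge0 ?f0 ?g0.
rewrite !ge0_integralE//; apply: ereal_sup_add_le.
- exists nnsfun0; last exact: sintegral0.
  by move=> x /=; rewrite /patch; case: ifP => // /set_mem /f0.
- exists nnsfun0; last exact: sintegral0.
  by move=> x /=; rewrite /patch; case: ifP => // /set_mem /g0.
- move=> _ _ [h hf <-] [k kg <-].
  apply: ereal_sup_ubound; exists (add_nnsfun h k); last by rewrite sintegralD.
  move=> x /=; have := hf x; have := kg x; rewrite /patch; case: ifP => _.
    by move=> kx hx; rewrite EFinD; exact: leeD.
  by move=> kx hx; rewrite EFinD; apply: le_trans (leeD hx kx) _; rewrite adde0.
- by move=> _ [h _ <-]; exact: sintegral_ge0.
- by move=> _ [h _ <-]; exact: sintegral_ge0.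
Qed.

(** A simple function below [f] on [D] can be replaced by one that vanishes
    off [D], so only its integral over [D] matters. This reduces inequalities
    for lower integrals to measurable integrands. *)
Lemma lower_integral_le D f c : (forall x, D x -> 0 <= f x) ->
  (forall h : {nnsfun T >-> R}, (forall x, D x -> (h x)%:E <= f x) ->
    \int[mu]_(x in D) (h x)%:E <= c) ->
  measurable D ->
  \int[mu]_(x in D) f x <= c.
Proof.
move=> f0 hc mD; rewrite ge0_integralE//; apply: ge_ereal_sup => _ [h /= hf <-].
have hD x : D x -> (h x)%:E <= f x.
  by move=> Dx; have := hf x; rewrite /patch mem_set.
apply: le_trans (hc _ hD); rewrite integral_nnsfun//.
rewrite (_ : (h : T -> R) \_ D = h)//; apply/funext => x; rewrite /patch.
case: ifPn => // xD; apply/esym/eqP; rewrite eq_le; apply/andP; split; last exact: fun_ge0.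
by have := hf x; rewrite /patch (negbTE xD) lee_fin.
Qed.

Lemma lower_integral_setU (A B : set T) f : measurable A -> measurable B ->
  [disjoint A & B] -> (forall x, (A `|` B) x -> 0 <= f x) ->
  \int[mu]_(x in A `|` B) f x <= \int[mu]_(x in A) f x + \int[mu]_(x in B) f x.
Proof.
move=> mA mB AB f0; apply: lower_integral_le => //; last exact: measurableU.
move=> h hf; rewrite ge0_integral_setU//; last 2 first.
- by apply/measurable_EFinP; exact: measurable_funTS.
- by move=> x _; rewrite lee_fin.
apply: leeD; apply: le_lower_integral => x Ax; rewrite ?lee_fin//; apply: hf.
- by left.
- by right.
Qed.

Lemma lower_integral_bigcup (F : (set T)^nat) f :
  (forall k, measurable (F k)) -> trivIset setT F ->
  (forall x, (\bigcup_k F k) x -> 0 <= f x) ->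
  \int[mu]_(x in \bigcup_k F k) f x <= \sum_(k <oo) \int[mu]_(x in F k) f x.
Proof.
move=> mF tF f0; apply: lower_integral_le => //; last exact: bigcup_measurable.
move=> h hf; rewrite ge0_integral_bigcup//; last 2 first.
- by apply/measurable_EFinP; exact: measurable_funTS.
- by move=> x _; rewrite lee_fin.
apply: lee_nneseries => [k _ _|k _].
  by apply: integral_ge0 => x _; rewrite lee_fin.
apply: le_lower_integral => x Fx; rewrite ?lee_fin//; apply: hf.
by exists k.
Qed.

(** Multiplication by [c > 0] is a bijection between the simple functions
    below [f] and those below [c f]. *)
Lemma lower_integralZl D f (c : R) : (0 < c)%R -> measurable D ->
  (forall x, D x -> 0 <= f x) ->
  \int[mu]_(x in D) (c%:E * f x) <= c%:E * \int[mu]_(x in D) f x.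
Proof.
move=> c0 mD f0; apply: lower_integral_le => //.
  by move=> x Dx; rewrite mule_ge0 ?f0// lee_fin ltW.
move=> h hf; pose g : {nnsfun T >-> R} := scale_nnsfun h (ltW (divr_gt0 ltr01 c0)).
apply: (@le_trans _ _ (\int[mu]_(x in D) (c%:E * (g x)%:E))).
  apply: le_lower_integral => x Dx; first by rewrite lee_fin.
  by rewrite -EFinM lee_fin /g /= mul1r mulrA divff ?mul1r// gt_eqF.
rewrite ge0_integralZl_EFin//; last 3 first.
- by move=> x _; rewrite lee_fin.
- by apply/measurable_EFinP; exact: measurable_funTS.
- exact: ltW.
apply: lee_wpmul2l; first by rewrite lee_fin ltW.
apply: le_lower_integral => x Dx; first by rewrite lee_fin.
rewrite /g /= mul1r EFinM -lee_pdivlMl ?invr_gt0// invrK; exact: hf.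
Qed.

End lower_integral.

(** * Complex derivatives as first-order estimates *)

Section complex_calculus.
Context {R : realType}.
Implicit Types (z w : R[i]) (f : R[i] -> R[i]).

Lemma normc_real_gt0 (e : R[i]) : 0 < e -> e = (Re e)%:C /\ 0 < Re e.
Proof. by case: e => a b; rewrite ltcE /= => /andP[/eqP -> ->]. Qed.

Lemma normcEC (z : R[i]) : `|z| = (normc z)%:C.
Proof. by case: z. Qed.

Lemma normc_ge0 z : 0 <= normc z.
Proof. by case: z => a b; exact: sqrtr_ge0. Qed.

Lemma normc_gt0 z : z != 0 -> 0 < normc z.
Proof.
by move=> z0; rewrite lt_def normc_ge0 andbT; apply: contra_neq z0 => /eq0_normc.
Qed.

Lemma normc_opp z : normc (- z) = normc z.
Proof. exact: normcN. Qed.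

Lemma ler_normcD z w : normc (z + w) <= normc z + normc w.
Proof. exact: le_normcD. Qed.

Lemma ler_dist_normc z w : `|normc z - normc w| <= normc (z - w).
Proof.
rewrite ler_norml; apply/andP; split.
  rewrite -[leRHS]opprB lerN2 lerBlDr -[X in _ <= X + _]normc_opp opprB.
  by apply: le_trans (ler_normcD _ _); rewrite subrK.
by rewrite lerBlDr; apply: le_trans (ler_normcD _ _); rewrite subrK.
Qed.

(** Differentiability over the field [R[i]] is a limit whose radii are
    themselves complex numbers; this form with real radii is the one on which
    everything below relies. *)
Lemma cderiv_approx f z : cderivable f z -> forall e : R, 0 < e ->
  exists2 d : R, 0 < d & forall h, normc h < d ->
    normc (f (z + h) - f z - cderiv f z * h) <= e * normc h.
Proof.
move=> fz e e0.
move: (fz); rewrite /cderivable /derivable => /cvg_ex[l lP].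
have dE : cderiv f z = l.
  by rewrite /cderiv derive1E; exact: (cvg_lim (@norm_hausdorff _ _) lP).
move/cvgrPdist_lt : lP => /(_ e%:C); rewrite ltcR => /(_ e0).
rewrite near_withinE => /nbhs_ballP[d /= /normc_real_gt0[dE' d0] H].
exists (Re d) => // h hd; have [->|h0] := eqVneq h 0.
  by rewrite addr0 subrr mulr0 subr0 normc0 mulr0.
have := H h.
rewrite /ball /= sub0r normrN normcEC.
rewrite dE' ltcR => /(_ hd h0); rewrite normcEC ltcR => Hh.
have -> : f (z + h) - f z - cderiv f z * h
    = - (l - h^-1 *: (f (h%:A + z) - f z)) * h.
  rewrite dE (_ : h%:A = h :> R[i]); last by rewrite /GRing.scale /= mulr1.
  by rewrite /GRing.scale /= (addrC h z); field.
by rewrite normcM normc_opp ler_wpM2r ?normc_ge0// ltW.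
Qed.

Lemma cderivable_continuous f z : cderivable f z -> forall e : R, 0 < e ->
  exists2 d : R, 0 < d & forall w, normc (w - z) < d -> normc (f w - f z) < e.
Proof.
move=> fz e e0; have [d d0 fd] := cderiv_approx fz ltr01.
pose k := 1 + normc (cderiv f z).
have k0 : 0 < k by rewrite /k ltr_wpDr// normc_ge0.
exists (Num.min d (e / k)).
  by rewrite lt_min d0 divr_gt0.
move=> w; rewrite lt_min => /andP[/fd]; rewrite (addrC z) subrK mul1r.
set h := w - z => H; rewrite ltr_pdivlMr// => hk.
rewrite (_ : f w - f z = (f w - f z - cderiv f z * h) + cderiv f z * h).
  apply: le_lt_trans (ler_normcD _ _) _; rewrite normcM.
  by apply: le_lt_trans hk; rewrite [leRHS]mulrC /k mulrDl mul1r lerD2r.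
by rewrite subrK.
Qed.

Lemma is_derive_approx (g : R -> R) (t d : R) :
  (forall e : R, 0 < e -> exists2 k : R, 0 < k & forall h : R, `|h| < k ->
     `|g (t + h) - g t - d * h| <= e * `|h|) ->
  is_derive t 1 g d.
Proof.
move=> H.
have cv : h^-1 *: (g (h *: 1 + t) - g t) @[h --> 0^'] --> d.
  apply/cvgrPdist_le => e e0; have [k k0 gk] := H e e0.
  rewrite near_withinE; apply/nbhs_ballP; exists k => // h /=.
  rewrite /ball /= sub0r normrN => /gk hk h0.
  have -> : d - h^-1 *: (g (h *: 1 + t) - g t)
      = - ((g (t + h) - g t - d * h) / h).
    rewrite /GRing.scale /= mulr1 (addrC h t); field; exact: h0.
  by rewrite normrN normrM normfV ler_pdivrMr ?normr_gt0.
split; first by apply/cvg_ex; exists d.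
exact: cvg_lim cv.
Qed.

Lemma ler_normRe z : `|Re z| <= normc z.
Proof.
case: z => a b /=; rewrite -sqrtr_sqr; apply: ler_wsqrtr.
by rewrite lerDl sqr_ge0.
Qed.

Lemma ler_normIm z : `|Im z| <= normc z.
Proof.
case: z => a b /=; rewrite -sqrtr_sqr; apply: ler_wsqrtr.
by rewrite lerDr sqr_ge0.
Qed.

Lemma ler_normcReIm z : normc z <= `|Re z| + `|Im z|.
Proof.
case: z => a b /=.
rewrite -[leRHS]ger0_norm ?addr_ge0// -sqrtr_sqr; apply: ler_wsqrtr.
rewrite sqrrD !real_normK ?num_real// lerD2r lerDl.
by rewrite mulrn_wge0 // mulr_ge0.
Qed.

Lemma normc_realC (x : R) : normc x%:C = `|x|.
Proof. by rewrite /= expr0n /= addr0 sqrtr_sqr. Qed.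

Lemma ray_is_derive f (u zeta : R[i]) (t : R) : cderivable f (t%:C * zeta) ->
  is_derive t 1 (fun s : R => Re (u * f (s%:C * zeta)))
    (Re (u * zeta * cderiv f (t%:C * zeta))).
Proof.
move=> ft; apply: is_derive_approx => e e0.
pose n := 1 + normc u; pose m := 1 + normc zeta.
have n0 : 0 < n by rewrite /n ltr_wpDr// normc_ge0.
have m0 : 0 < m by rewrite /m ltr_wpDr// normc_ge0.
have [d d0 fd] := cderiv_approx ft (divr_gt0 e0 (mulr_gt0 n0 m0)).
exists (d / m); first exact: divr_gt0.
move=> h; rewrite ltr_pdivlMr// => hd.
have hz : normc (h%:C * zeta) <= `|h| * m.
  by rewrite normcM normc_realC ler_wpM2l// /m ler_wpDl.
have := fd (h%:C * zeta) (le_lt_trans hz hd).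
set D := _ - _ - _ => HD.
have -> : Re (u * f ((t + h)%:C * zeta)) - Re (u * f (t%:C * zeta)) -
    Re (u * zeta * cderiv f (t%:C * zeta)) * h = Re (u * D).
  rewrite /D rmorphD mulrDl.
  move: (f _) (f _) (cderiv _ _) => a b c.
  case: (u) (a) (b) (c) (zeta) => [? ?] [? ?] [? ?] [? ?] [? ?] /=.
  by ring.
apply: le_trans (ler_normRe _) _; rewrite normcM.
apply: (@le_trans _ _ (n * (e / (n * m) * (`|h| * m)))).
  apply: ler_pM; rewrite ?normc_ge0 //; first by rewrite /n ler_wpDl.
  by apply: le_trans HD _; rewrite ler_wpM2l// ltW// divr_gt0// mulr_gt0.
rewrite le_eqVlt; apply/orP; left; apply/eqP.
by field; rewrite !gt_eqF.
Qed.

End complex_calculus.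

(** * A comparison principle for second-order equations *)

Section comparison.
Context {R : realType}.

Lemma ge0_deriv_le (q q1 : R -> R) (a b : R) : a <= b ->
  (forall x, a <= x <= b -> is_derive x 1 q (q1 x)) ->
  (forall x, a < x < b -> 0 <= q1 x) -> q a <= q b.
Proof.
rewrite le_eqVlt => /predU1P[->//|ab] dq q10.
have [||x] := @MVT R q q1 a b ab.
- by move=> x; rewrite in_itv /= => /andP[ax xb]; apply: dq; rewrite !ltW.
- apply: derivable_within_continuous => x; rewrite in_itv /= => xab.
  by apply: ex_derive; exact: dq.
rewrite in_itv /= => /q10 qx0 E; rewrite -subr_ge0 E mulr_ge0// subr_ge0 ltW//.
Qed.

(** A modulus is not differentiable at zeros, but it is attained as the real
    part of a rotation, which is differentiable wherever the function is. *)
Lemma unit_rotation (z : R[i]) :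
  exists2 u : R[i], normc u = 1 & Re (u * z) = normc z.
Proof.
have [->|z0] := eqVneq z 0; first by exists 1; rewrite ?normc1// mulr0 normc0.
have nz := normc_gt0 z0.
exists ((normc z)%:C / z).
  by rewrite normcM normcV normc_realC ger0_norm ?normc_ge0// divff// gt_eqF.
by rewrite divfK.
Qed.

(** At a first point [s0] where [|G| >= y], choose the rotation [u] with
    [Re (u G s0) = |G s0|] and put [q = y - Re (u G)]. Before [s0] one has
    [|G| < y], so [q'' >= a y - a |G| >= 0]; with [q' 0 >= 0] and [q 0 > 0]
    this makes [q s0] positive, although [q s0 = y s0 - |G s0| <= 0]. *)
Lemma ode_comparison (b : R) (G G1 G2 : R -> R[i]) (y y1 y2 a : R -> R) :
  (forall u t, 0 <= t < b ->
    is_derive t 1 (fun s => Re (u * G s)) (Re (u * G1 t))) ->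
  (forall u t, 0 <= t < b ->
    is_derive t 1 (fun s => Re (u * G1 s)) (Re (u * G2 t))) ->
  (forall t, 0 <= t < b -> {for t, continuous (fun s => normc (G s))}) ->
  (forall t, 0 <= t < b -> is_derive t 1 y (y1 t)) ->
  (forall t, 0 <= t < b -> is_derive t 1 y1 (y2 t)) ->
  (forall t, 0 <= t < b -> 0 <= a t) ->
  (forall t, 0 <= t < b -> normc (G2 t) <= a t * normc (G t)) ->
  (forall t, 0 <= t < b -> a t * y t <= y2 t) ->
  normc (G 0) < y 0 -> normc (G1 0) <= y1 0 ->
  forall t, 0 <= t < b -> normc (G t) < y t.
Proof.
move=> dG dG1 cG dy dy1 a0 G2le y2ge G0 G10 t /andP[t0 tb].
rewrite ltNge; apply/negP => ytG.
pose S := [set s : R | 0 <= s <= t /\ y s <= normc (G s)].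
have St : S t by split => //; rewrite t0 lexx.
have lbS : lbound S 0 by move=> s [/andP[]].
have iS : has_inf S by split; [exists t | exists 0].
pose s0 := inf S.
have s00 : 0 <= s0 by apply: lb_le_inf => //; exists t.
have s0t : s0 <= t by apply: ge_inf => //; exists 0.
have s0b : 0 <= s0 < b by rewrite s00 (le_lt_trans s0t).
have ltS s : 0 <= s < s0 -> normc (G s) < y s.
  move=> /andP[s0' ss]; rewrite ltNge; apply/negP => ysG.
  have : s0 <= s.
    apply: ge_inf; first by exists 0.
    by split => //; rewrite s0' (le_trans (ltW ss) s0t).
  by rewrite leNgt ss.
have ys0G : y s0 <= normc (G s0).
  rewrite leNgt; apply/negP => Gs0.
  have cy : {for s0, continuous y}.
    by apply/differentiable_continuous/derivable1_diffP/ex_derive; exact: dy.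
  (* By continuity [s0] would otherwise have a neighbourhood free of [S]. *)
  have : \forall s \near s0, 0 < y s - normc (G s).
    have lim : (fun s => y s - normc (G s)) s @[s --> s0]
        --> y s0 - normc (G s0).
      by apply: cvgB; [exact: cy | exact: cG].
    by apply: (cvgr_gt _ lim); rewrite subr_gt0.
  move=> /nbhs_ballP[e /= e0 He].
  have [s [/andP[s0' st] ysG] ss] := inf_adherent e0 iS.
  have : ball s0 e s.
    rewrite /ball /= distrC ger0_norm ?ltrBlDl// subr_ge0.
    by apply: ge_inf; [exists 0 | split => //; rewrite s0'].
  by move/He; rewrite subr_gt0 ltNge ysG.
have s0_gt0 : 0 < s0.
  rewrite lt_def s00 andbT; apply: contraTneq ys0G => ->.
  by rewrite -ltNge.
have [u u1 uG] := unit_rotation (G s0).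
have inb s : 0 <= s <= s0 -> 0 <= s < b.
  by move=> /andP[-> ss]; rewrite (le_lt_trans ss) //; case/andP: s0b.
have Reu z : Re (u * z) <= normc z.
  by apply: le_trans (ler_norm _) _; apply: le_trans (ler_normRe _) _; rewrite normcM u1 mul1r.
pose q s := y s - Re (u * G s).
pose q1 s := y1 s - Re (u * G1 s).
pose q2 s := y2 s - Re (u * G2 s).
have dq s : 0 <= s <= s0 -> is_derive s 1 q (q1 s).
  by move=> /inb sb; apply: is_deriveB; [exact: dy | exact: dG].
have dq1 s : 0 <= s <= s0 -> is_derive s 1 q1 (q2 s).
  by move=> /inb sb; apply: is_deriveB; [exact: dy1 | exact: dG1].
have q2ge s : 0 <= s < s0 -> 0 <= q2 s.
  move=> ss; have sb : 0 <= s < b by apply: inb; case/andP: ss => -> /ltW.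
  rewrite subr_ge0; apply: le_trans (Reu _) _.
  apply: le_trans (G2le _ sb) _; apply: le_trans (y2ge _ sb).
  by rewrite ler_wpM2l ?a0// ltW// ltS.
have q1ge s : 0 < s < s0 -> 0 <= q1 s.
  move=> /andP[s0' ss].
  apply: (@le_trans _ _ (q1 0)).
    by rewrite subr_ge0; exact: le_trans (Reu _) _.
  apply: (@ge0_deriv_le _ q2 0 s (ltW s0')).
    by move=> x /andP[x0 xs]; apply: dq1; rewrite x0 (le_trans xs)// ltW.
  by move=> x /andP[x0 xs]; apply: q2ge; rewrite ltW//= (lt_trans xs).
have : q 0 <= q s0.
  by apply: (@ge0_deriv_le _ q1 0 s0 s00) => // x; exact: dq.
rewrite leNgt => /negP; apply.
apply: (@le_lt_trans _ _ 0).
  by rewrite /q uG subr_le0.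
by rewrite subr_gt0 (le_lt_trans (Reu _)).
Qed.

End comparison.

(** * The majorant of the solutions *)

Section growth.
Context {R : realType}.
Implicit Types t c m : R.

(** The weight of the theorem as a function of the modulus alone. *)
Definition radial_weight t : R := 1 - ln (1 - t).

Lemma log_weight_radial (z : R[i]) : normc z < 1 -> log_weight z = radial_weight (normc z).
Proof.
move=> z1; rewrite /log_weight /radial_weight ln_div ?posrE ?expR_gt0 ?subr_gt0//.
by rewrite expRK.
Qed.

Lemma radial_weight_ge1 t : 0 <= t < 1 -> 1 <= radial_weight t.
Proof.
move=> /andP[t0 t1]; rewrite /radial_weight lerDl oppr_ge0 ln_le0//.
by rewrite lerBlDr lerDl.
Qed.

Lemma expR_radial_weight t : t < 1 -> expR (1 - radial_weight t) = 1 - t.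
Proof. by move=> t1; rewrite /radial_weight opprB addrC subrK lnK// posrE subr_gt0. Qed.

Lemma is_derive_radial_weight t : t < 1 -> is_derive t 1 radial_weight (1 - t)^-1.
Proof.
move=> t1; have x0 : 0 < 1 - t by rewrite subr_gt0.
have d1 : is_derive t 1 (fun s : R => 1 - s) (0 - 1) by exact: is_deriveB.
have d2 := @is_derive1_comp _ (@ln R) (fun s : R => 1 - s) t _ _ (is_derive1_ln x0) d1.
have d3 : is_derive t 1 (fun s : R => 1 - ln (1 - s)) (0 - (1 - t)^-1 * (0 - 1)).
  by apply: is_deriveB.
by apply: is_derive_eq d3 _; ring.
Qed.

(** The logarithm of the majorant [L^c exp (m t)], followed by its first two
    derivatives. In these terms the second derivative of the majorant is its
    product with [log_majorant2 + log_majorant1 ^ 2]. *)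
Definition log_majorant c m t : R := c * ln (radial_weight t) + m * t.
Definition log_majorant1 c m t : R := c / (radial_weight t * (1 - t)) + m.
Definition log_majorant2 c t : R := c / (radial_weight t * (1 - t) ^+ 2) *
  (1 - (radial_weight t)^-1).

Lemma is_derive_log_majorant c m t : 0 <= t < 1 ->
  is_derive t 1 (log_majorant c m) (log_majorant1 c m t).
Proof.
move=> t01; have L0 : 0 < radial_weight t := lt_le_trans ltr01 (radial_weight_ge1 t01).
have t1 : t < 1 by case/andP: t01.
have x0 : 1 - t != 0 by rewrite subr_eq0 eq_sym lt_eqF.
have d1 := @is_derive1_comp _ (@ln R) radial_weight t _ _
  (is_derive1_ln L0) (is_derive_radial_weight t1).
have d2 : is_derive t 1 (fun s => c *: (@ln R \o radial_weight) s + m *: id s)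
    (c *: ((radial_weight t)^-1 * (1 - t)^-1) + m *: 1) by exact: is_deriveD.
apply: is_derive_eq d2 _; rewrite /GRing.scale /= /log_majorant1; field.
by rewrite x0 gt_eqF.
Qed.

Lemma is_derive_log_majorant1 c m t : 0 <= t < 1 ->
  is_derive t 1 (log_majorant1 c m) (log_majorant2 c t).
Proof.
move=> t01; have L0 : 0 < radial_weight t := lt_le_trans ltr01 (radial_weight_ge1 t01).
have t1 : t < 1 by case/andP: t01.
have x0 : 1 - t != 0 by rewrite subr_eq0 eq_sym lt_eqF.
have dL := is_derive_radial_weight t1.
have d1 : is_derive t 1 (fun s : R => 1 - s) (0 - 1) by exact: is_deriveB.
have d2 := is_deriveM dL d1.
have nz : (radial_weight * (fun s : R => 1 - s)) t != 0.
  by rewrite /GRing.mul /= mulf_neq0// gt_eqF.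
have d3 := is_deriveV nz d2.
have d4 : is_derive t 1 (fun s => c *: ((radial_weight * (fun s : R => 1 - s)) s)^-1 + m)
   (c *: (- ((radial_weight * (fun s : R => 1 - s)) t) ^- 2 *:
     (radial_weight t *: (0 - 1) + (1 - t) *: (1 - t)^-1)) + 0).
  exact: is_deriveD.
apply: is_derive_eq d4 _; rewrite /GRing.scale /= /log_majorant2.
rewrite [X in X ^- 2](_ : _ = radial_weight t * (1 - t)) //.
by field; rewrite x0 gt_eqF.
Qed.

(** Put [x = 1 - t]. After multiplication by [x^2 L] the claim becomes
    [alpha <= (c (1 - 1/L) + m^2 x^2 L) (2 - x)^2]. For large [L] the first term
    is enough, because [x <= 1/L] makes the product at least
    [4 c (1 - 2/L)]; for bounded [L] the number [x] is bounded below and a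
    large [m] does it. *)
Lemma log_majorant_ineq (alpha c : R) : 0 <= alpha -> alpha < 4 * c ->
  exists2 m : R, 0 <= m & forall t, 0 <= t < 1 ->
    alpha / ((1 - t ^+ 2) ^+ 2 * radial_weight t) <= log_majorant2 c t + log_majorant1 c m t ^+ 2.
Proof.
move=> a0 ac; have c0 : 0 < c by nra.
(* [l] is the value of [L] from which on [alpha <= 4 c (1 - 2 / L)]. *)
pose l := 8 * c / (4 * c - alpha).
exists ((alpha + 1) * expR l) => [|t t01].
  by rewrite mulr_ge0 ?expR_ge0 ?addr_ge0.
set m := _ * expR l.
have m0 : 0 <= m by rewrite mulr_ge0 ?expR_ge0 ?addr_ge0.
have L1 := radial_weight_ge1 t01.
have L0 : 0 < radial_weight t := lt_le_trans ltr01 L1.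
have [t0 t1] := andP t01.
have E := expR_radial_weight t1.
set L := radial_weight t in L1 L0 E *; pose x := 1 - t.
have x0 : 0 < x by rewrite subr_gt0.
have x1 : x <= 1 by rewrite /x lerBlDr lerDl.
have i0 : 0 < L^-1 by rewrite invr_gt0.
have i1 : L^-1 <= 1 by rewrite invf_le1.
have m1 : m ^+ 2 <= log_majorant1 c m t ^+ 2.
  have n1 : 0 <= c / (L * (1 - t)).
    by rewrite divr_ge0 ?(ltW c0)// mulr_ge0 ?(ltW L0)// subr_ge0 ltW.
  by rewrite /log_majorant1 -/L; nra.
apply: le_trans (lerD (lexx _) m1).
rewrite /log_majorant2 -/L -/x.
suff H : alpha <= (c * (1 - L^-1) + m ^+ 2 * x ^+ 2 * L) * (2 - x) ^+ 2.
  have -> : 1 - t ^+ 2 = x * (2 - x) by rewrite /x; ring.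
  rewrite ler_pdivrMr; last by rewrite mulr_gt0// exprn_gt0// mulr_gt0//; lra.
  have -> : (c / (L * x ^+ 2) * (1 - L^-1) + m ^+ 2) * ((x * (2 - x)) ^+ 2 * L)
    = (c * (1 - L^-1) + m ^+ 2 * x ^+ 2 * L) * (2 - x) ^+ 2 => //.
  by field; rewrite !gt_eqF.
have [lL|Ll] := leP l L.
(* [1 / x = exp (L - 1) >= L] *)
- have xi : x <= L^-1.
    rewrite /x -E -opprB expRN lef_pV2 ?posrE ?expR_gt0//.
    by have := expR_ge1Dx (L - 1); rewrite addrC subrK.
  have al : alpha <= 4 * c * (1 - 2 * L^-1).
    move: lL; rewrite /l ler_pdivrMr ?subr_gt0// => lL.
    rewrite -(ler_pM2l L0).
    have -> : L * (4 * c * (1 - 2 * L^-1)) = 4 * c * L - 8 * c.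
      by field; rewrite gt_eqF.
    by lra.
  have mx : 0 <= m ^+ 2 * x ^+ 2 * L by exact: mulr_ge0 (mulr_ge0 (sqr_ge0 _) (sqr_ge0 _)) (ltW L0).
  apply: le_trans al _.
  have h1 : 4 * (1 - L^-1) <= (2 - x) ^+ 2 by nra.
  have h2 : 0 <= c * (1 - L^-1) by apply: mulr_ge0; [exact: ltW|rewrite subr_ge0].
  apply: (@le_trans _ _ (c * (1 - L^-1) * (2 - x) ^+ 2)).
    by nra.
  by rewrite ler_wpM2r ?sqr_ge0// lerDl.
- have mx : alpha + 1 <= m * x.
    rewrite /m /x -E -mulrA -expRD -[leLHS]mulr1 ler_wpM2l ?addr_ge0//.
    rewrite -[leLHS]expR0 ler_expR; lra.
  have mx2 : alpha <= m ^+ 2 * x ^+ 2 by rewrite -exprMn; move: mx; move: (m * x) => p mx; nra.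
  have h1 : 0 <= c * (1 - L^-1) by apply: mulr_ge0; [exact: ltW|rewrite subr_ge0].
  have h2 : 1 <= (2 - x) ^+ 2 by nra.
  have h3 : alpha <= m ^+ 2 * x ^+ 2 * L by nra.
  by nra.
Qed.

End growth.

(** * Growth of the solutions *)

Section ode_growth.
Context {R : realType}.
Implicit Types f A : R[i] -> R[i].

Lemma normc_ray_continuous f (zeta : R[i]) (t : R) : normc zeta = 1 ->
  cderivable f (t%:C * zeta) ->
  {for t, continuous (fun s : R => normc (f (s%:C * zeta)))}.
Proof.
move=> z1 ft; apply/cvgrPdist_lt => e e0.
have [d d0 fd] := cderivable_continuous ft e0.
apply/nbhs_ballP; exists d => // s; rewrite /ball /= distrC => sd.
have := fd (s%:C * zeta).
rewrite -mulrBl -rmorphB normcM z1 mulr1 normc_realC => /(_ sd).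
by apply: le_lt_trans; rewrite distrC; exact: ler_dist_normc.
Qed.

Lemma ode_growth f A (alpha c : R) : 0 <= alpha -> alpha < 4 * c ->
  (forall z, normc z < 1 ->
     normc (A z) * (1 - normc z ^+ 2) ^+ 2 * radial_weight (normc z) <= alpha) ->
  analytic (@unit_disc R) f -> solves_ode (@unit_disc R) A f ->
  exists2 K : R, 0 < K &
    forall z, normc z < 1 -> normc (f z) <= K * expR (c * ln (radial_weight (normc z))).
Proof.
move=> a0 ac HA fan fode.
have c0 : 0 < c by nra.
have [m m0 Hm] := log_majorant_ineq a0 ac.
(* The summands give [|f 0| < y 0] and [|f' 0| <= c K <= y' 0]. *)
pose K := normc (f 0) + 1 + normc (cderiv f 0) / c.
have K0 : 0 < K.
  by rewrite /K ltr_pwDl ?divr_ge0 ?normc_ge0 ?(ltW c0)// ltr_wpDl ?normc_ge0.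
exists (K * expR m); first by rewrite mulr_gt0 ?expR_gt0.
pose y (t : R) : R := K * expR (log_majorant c m t).
pose y1 (t : R) : R := y t * log_majorant1 c m t.
pose y2 (t : R) : R := y t * (log_majorant2 c t + log_majorant1 c m t ^+ 2).
have y0 t : 0 < y t by rewrite /y mulr_gt0 ?expR_gt0.
have dy (t : R) : 0 <= t < 1 -> is_derive t 1 y (y1 t).
  move=> t01; have d1 := is_derive_log_majorant c m t01.
  have d2 := @is_derive1_comp _ expR (log_majorant c m) t _ _ (is_derive_expR _) d1.
  have d3 : is_derive t 1 (fun s => K *: (expR \o log_majorant c m) s)
     (K *: (expR (log_majorant c m t) * log_majorant1 c m t)) by exact: is_deriveZ.
  by apply: is_derive_eq d3 _; rewrite /GRing.scale /= mulrA.
have dy1 (t : R) : 0 <= t < 1 -> is_derive t 1 y1 (y2 t).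
  move=> t01; have d1 := is_derive_log_majorant1 c m t01.
  have d2 := is_deriveM (dy _ t01) d1.
  by apply: is_derive_eq d2 _; rewrite /GRing.scale /= /y1 /y2; ring.
pose a (t : R) : R := alpha / ((1 - t ^+ 2) ^+ 2 * radial_weight t).
have w0 (t : R) : 0 <= t < 1 -> 0 < (1 - t ^+ 2) ^+ 2 * radial_weight t.
  move=> t01; apply: mulr_gt0; last exact: lt_le_trans ltr01 (radial_weight_ge1 t01).
  by case/andP: t01 => t0 t1; rewrite exprn_gt0//; nra.
have ray_growth (zeta : R[i]) (t : R) : normc zeta = 1 -> 0 <= t < 1 ->
    normc (f (t%:C * zeta)) < y t.
  move=> z1.
  have nray (s : R) : 0 <= s < 1 -> normc (s%:C * zeta) = s.
    by move=> /andP[s0 s1]; rewrite normcM z1 mulr1 normc_realC ger0_norm.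
  have inD (s : R) : 0 <= s < 1 -> unit_disc (s%:C * zeta).
    by move=> s01; rewrite /unit_disc /= nray//; case/andP: s01.
  apply: (@ode_comparison _ 1 (fun s => f (s%:C * zeta))
    (fun s => zeta * cderiv f (s%:C * zeta))
    (fun s => zeta * zeta * cderiv (cderiv f) (s%:C * zeta)) y y1 y2 a).
  - move=> u s s01; rewrite mulrA; apply: ray_is_derive.
    exact: fan (inD _ s01).
  - move=> u s s01.
    rewrite (_ : (fun x : R => _) =
      (fun x : R => Re (u * zeta * cderiv f (x%:C * zeta)))); last first.
      by apply/funext => x; rewrite mulrA.
    rewrite (_ : u * (zeta * zeta * _) = u * zeta * zeta * cderiv (cderiv f) (s%:C * zeta)).
      by apply: ray_is_derive; exact: (fode _ (inD _ s01)).1.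
    by rewrite !mulrA.
  - by move=> s s01; apply: normc_ray_continuous => //; exact: fan (inD _ s01).
  - by move=> s s01; rewrite divr_ge0// ltW// w0.
  - move=> s s01; rewrite !normcM z1 !mul1r.
    have /eqP := (fode _ (inD _ s01)).2; rewrite addr_eq0 => /eqP ->.
    rewrite normc_opp normcM ler_wpM2r ?normc_ge0// /a ler_pdivlMr ?w0//.
    by have := HA _ (inD _ s01); rewrite nray// => H; rewrite mulrA; exact: H.
  - move=> s s01; rewrite /y2 mulrC ler_wpM2l ?(ltW (y0 _))//; exact: Hm.
  - rewrite mul0r /y /log_majorant mulr0 addr0 /radial_weight subr0 ln1 subr0 ln1 mulr0 expR0 mulr1.
    by rewrite /K -addrA ltrDl ltr_pwDl// divr_ge0 ?normc_ge0// ltW.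
  - rewrite mul0r normcM z1 mul1r /y1 /y /log_majorant mulr0 addr0.
    rewrite /log_majorant1 /radial_weight subr0.
    rewrite ln1 subr0 ln1 mulr0 expR0 mulr1 mul1r divr1 /K.
    apply: (@le_trans _ _ (normc (cderiv f 0) / c * c)); first by rewrite divfK// gt_eqF.
    apply: ler_pM; rewrite ?divr_ge0 ?normc_ge0 ?(ltW c0)//.
      by rewrite lerDr addr_ge0 ?normc_ge0.
    by rewrite lerDl.
move=> z z1.
have zn : 0 <= normc z < 1 by rewrite normc_ge0.
have [zeta zeta1 zE] : exists2 zeta, normc zeta = 1 & z = (normc z)%:C * zeta.
  have [->|z0] := eqVneq z 0; first by exists 1; rewrite ?normc1// normc0 mul0r.
  have nz := normc_gt0 z0.
  exists (z / (normc z)%:C).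
    by rewrite normcM normcV normc_realC ger0_norm ?normc_ge0// divff// gt_eqF.
  by rewrite mulrCA divff ?mulr1// -(rmorph0 (real_complex R)) (inj_eq (@complexI _)) gt_eqF.
rewrite {1}zE; apply: le_trans (ltW (ray_growth _ _ zeta1 zn)) _.
rewrite /y /log_majorant expRD -!mulrA ler_wpM2l ?(ltW K0)// mulrC ler_wpM2r ?expR_ge0//.
by rewrite ler_expR ler_piMr// ltW.
Qed.

End ode_growth.

(** * Counting and bisecting *)

Section counting_sets.

(** This makes the number of preimages superadditive in the domain. *)
Lemma counting_setU_ge (T : choiceType) (R : realType) (X Y : set T) :
  X `&` Y = set0 ->
  (counting X + counting Y <= counting (X `|` Y) :> \bar R)%E.
Proof.
move=> XY; rewrite /counting.
have [fU|iU] := pselect (finite_set (X `|` Y)); last by rewrite [in leRHS]asboolF ?leey.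
have [fX fY] : finite_set X /\ finite_set Y by rewrite -finite_setU.
rewrite !asboolT// -EFinD -natrD lee_fin ler_nat fset_setU// finmap.cardfsU.
rewrite -fset_setI// XY fset_set0 finmap.cardfs0 subn0 leqnn//.
Qed.

Lemma counting_ge0 (T : choiceType) (R : realType) (X : set T) : (0 <= counting X :> \bar R)%E.
Proof. by rewrite /counting; case: ifP; rewrite ?leey. Qed.

Lemma counting_ge1 (T : choiceType) (R : realType) (X : set T) t : X t ->
  (1 <= counting X :> \bar R)%E.
Proof.
move=> Xt; rewrite /counting; case: ifPn => [/asboolP fX|_]; last by rewrite leey.
rewrite lee_fin ler1n finmap.cardfs_gt0; apply/eqP => X0.
by have := mem_set Xt; rewrite -(in_fset_set fX) X0 finmap.in_fset0.
Qed.

Lemma le_counting (T : choiceType) (R : realType) (X Y : set T) : X `<=` Y ->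
  (counting X <= counting Y :> \bar R)%E.
Proof.
move=> XY; rewrite -(setDUK XY); apply: (le_trans _ (counting_setU_ge _ _)).
  by rewrite leeDl// counting_ge0.
by rewrite setDIK.
Qed.

End counting_sets.

Section squares.
Context {R : realType}.
Implicit Types x y s : R.

(** Every left end is below every right end, so the supremum of the left ends
    lies in all the intervals. *)
Lemma nested_intervals (v w : nat -> R) :
  (forall n, 0 <= w n) -> (forall n, v n <= v n.+1) ->
  (forall n, v n.+1 + w n.+1 <= v n + w n) ->
  exists a, forall n, v n <= a <= v n + w n.
Proof.
move=> w0 v1 vw1.
have vmono m n : (m <= n)%N -> v m <= v n.
  exact: (homo_leq (@lexx _ _) (@le_trans _ _)).
have vwmono m n : (m <= n)%N -> v n + w n <= v m + w m.
  apply: (homo_leq (f := fun k => v k + w k) (r := fun a b => b <= a)) => //.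
  by move=> b a c ab bc; exact: le_trans bc ab.
have ub m n : v m <= v n + w n.
  have [mn|nm] := leqP m n.
    by apply: le_trans (vmono _ _ mn) _; rewrite lerDl.
  by apply: le_trans (vwmono _ _ (ltnW nm)); rewrite lerDl.
exists (sup (range v)) => n; apply/andP; split.
  apply: ub_le_sup; last by exists n.
  by exists (v 0%N + w 0%N) => _ [m _ <-].
by apply: ge_sup; [exists (v 0%N), 0%N | move=> _ [m _ <-]].
Qed.

(** If [P] failed on a square, it would fail on one of the four quarters, and
    iterating gives nested squares that shrink to a point [(a, b)], against
    the local hypothesis there. The point may lie on the boundary of the
    squares, hence the closed conditions on [a] and [b]. *)
Lemma square_bisection (P : R -> R -> R -> Prop) :
  (forall x y s, 0 < s -> P x y (s / 2) -> P (x + s / 2) y (s / 2) ->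
     P x (y + s / 2) (s / 2) -> P (x + s / 2) (y + s / 2) (s / 2) -> P x y s) ->
  (forall a b, exists2 d, 0 < d & forall x y s, 0 < s < d ->
     x <= a <= x + s -> y <= b <= y + s -> P x y s) ->
  forall x y s, 0 < s -> P x y s.
Proof.
move=> Psplit Ploc x y s s0; apply: contrapT => nP.
have step (p : R * R) r : 0 < r -> ~ P p.1 p.2 r -> exists q : R * R,
    [/\ p.1 <= q.1 <= p.1 + r / 2, p.2 <= q.2 <= p.2 + r / 2 &
      ~ P q.1 q.2 (r / 2)].
  move=> r0 nPp; have r20 : 0 <= r / 2 by rewrite divr_ge0 ?ltW.
  have box a : a <= a <= a + r / 2 by rewrite lexx lerDl.
  have box' a : a <= a + r / 2 <= a + r / 2 by rewrite lexx lerDl r20.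
  apply: contrapT => H; apply: nPp; apply: Psplit => //; apply: contrapT => nPq; apply: H.
  - by exists p.
  - by exists (p.1 + r / 2, p.2).
  - by exists (p.1, p.2 + r / 2).
  - by exists (p.1 + r / 2, p.2 + r / 2).
pose w n : R := s / 2 ^+ n.
have w0 n : 0 < w n by rewrite divr_gt0 ?exprn_gt0.
have wS n : w n.+1 = w n / 2 by rewrite /w exprS; field.
have nextP n (p : R * R) : exists q : R * R, ~ P p.1 p.2 (w n) ->
    [/\ p.1 <= q.1 <= p.1 + w n / 2, p.2 <= q.2 <= p.2 + w n / 2 &
      ~ P q.1 q.2 (w n / 2)].
  have [nPp|nnPp] := pselect (~ P p.1 p.2 (w n)); last by exists p.
  by have [q Hq] := step _ _ (w0 n) nPp; exists q.
(* The implication inside [nextP] makes the choice of a failing quarter a total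
   function, so that the sequence can be defined by plain recursion. *)
pose next n p := projT1 (cid (nextP n p)).
pose u := fix u n := if n is k.+1 then next k (u k) else (x, y).
have uP n : ~ P (u n).1 (u n).2 (w n).
  elim: n => [|n IH] /=; first by rewrite /w expr0 divr1.
  by rewrite wS; have [_ _] := projT2 (cid (nextP n (u n))) IH.
have uS n : (u n).1 <= (u n.+1).1 <= (u n).1 + w n / 2 /\
            (u n).2 <= (u n.+1).2 <= (u n).2 + w n / 2.
  by have [? ? _] := projT2 (cid (nextP n (u n))) (uP n).
have half n : w n / 2 + w n / 2 = w n by field.
have [a Ha] : exists a, forall n, (u n).1 <= a <= (u n).1 + w n.
  apply: nested_intervals => n; first exact: ltW.
    by have [/andP[]] := uS n.
  by have [/andP[_ h] _] := uS n; rewrite wS -[in leRHS](half n) addrA lerD2r.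
have [b Hb] : exists b, forall n, (u n).2 <= b <= (u n).2 + w n.
  apply: nested_intervals => n; first exact: ltW.
    by have [_ /andP[]] := uS n.
  by have [_ /andP[_ h]] := uS n; rewrite wS -[in leRHS](half n) addrA lerD2r.
have [d d0 Hd] := Ploc a b.
pose n := Num.bound (s / d).
apply: (uP n); apply: Hd => //; rewrite w0 /= /w ltr_pdivrMr ?exprn_gt0//.
rewrite mulrC -ltr_pdivrMr//; apply: lt_le_trans (archi_boundP _) _.
  by rewrite divr_ge0 ?ltW.
by rewrite -natrX ler_nat ltnW// ltn_expl.
Qed.

(** Half-open, so that a square is the disjoint union of its quarters. *)
Definition square x y s : set (R * R) :=
  [set p | (x <= p.1 < x + s) && (y <= p.2 < y + s)].

Lemma measurable_square x y s : measurable (square x y s).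
Proof.
rewrite (_ : square x y s = `[x, x + s[ `*` `[y, y + s[); first exact: measurableX.
by apply/seteqP; split => p /=; rewrite !in_itv /= => /andP.
Qed.

Lemma square_split x y s :
  square x y s = (square x y (s / 2) `|` square (x + s / 2) y (s / 2)) `|`
    (square x (y + s / 2) (s / 2) `|` square (x + s / 2) (y + s / 2) (s / 2)).
Proof.
have E (a : R) : a + s = a + s / 2 + s / 2 by field.
apply/seteqP; split => -[p q]; rewrite /square /= !E.
  move=> /andP[/andP[a1 a2] /andP[b1 b2]].
  have [a3|a3] := ltP p (x + s / 2); have [b3|b3] := ltP q (y + s / 2).
  - by left; left; rewrite a1 b1.
  - by right; left; rewrite a1 b2.
  - by left; right; rewrite a2 b1.
  - by right; right; rewrite a2 b2.
by move=> [[]|[]] /andP[/andP[a1 a2] /andP[b1 b2]];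
  apply/andP; split; apply/andP; split; lra.
Qed.

Lemma square_splitI x y s :
  [/\ square x y (s / 2) `&` square (x + s / 2) y (s / 2) = set0,
      square x (y + s / 2) (s / 2) `&` square (x + s / 2) (y + s / 2) (s / 2) = set0 &
      (square x y (s / 2) `|` square (x + s / 2) y (s / 2)) `&`
      (square x (y + s / 2) (s / 2) `|` square (x + s / 2) (y + s / 2) (s / 2)) = set0].
Proof.
split; rewrite -subset0 => -[p q]; rewrite /square /=.
- by move=> [/andP[/andP[_ h] _] /andP[/andP[h' _] _]]; move: h; rewrite ltNge h'.
- by move=> [/andP[/andP[_ h] _] /andP[/andP[h' _] _]]; move: h; rewrite ltNge h'.
- by move=> [[]/andP[_ /andP[_ h]] []/andP[_ /andP[h' _]]]; move: h; rewrite ltNge h'.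
Qed.

End squares.

(** * Areas and preimage counts on squares *)

Section area.
Context {R : realType}.
Implicit Types x y s : R.

Definition area := (@lebesgue_measure R \x @lebesgue_measure R)%E.

Lemma area_square x y s : 0 < s -> area (square x y s) = (s ^+ 2)%:E.
Proof.
move=> s0; rewrite (_ : square x y s = `[x, x + s[ `*` `[y, y + s[); last first.
  by apply/seteqP; split => p /=; rewrite !in_itv /= => /andP.
have lm (a : R) : lebesgue_measure `[a, a + s[%classic = s%:E.
  by rewrite lebesgue_measure_itv /= lte_fin ltrDl s0 -EFinB addrAC subrr add0r.
rewrite /area product_measure1E// expr2 EFinM.
by congr (_ * _)%E; exact: lm.
Qed.

Lemma integral_square_split (g : R * R -> \bar R) x y s : (forall p, 0 <= g p)%E ->
  (\int[area]_(p in square x y s) g p <=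
   (\int[area]_(p in square x y (s / 2)) g p +
    \int[area]_(p in square (x + s / 2) y (s / 2)) g p) +
   (\int[area]_(p in square x (y + s / 2) (s / 2)) g p +
    \int[area]_(p in square (x + s / 2) (y + s / 2) (s / 2)) g p))%E.
Proof.
move=> g0; have [/eqP d1 /eqP d2 /eqP d3] := square_splitI x y s.
have g0' (D : set (R * R)) p : D p -> (0 <= g p)%E by [].
move: d1 d2 d3; rewrite -!disj_set2E (square_split x y s) => d1 d2 d3.
have mU x1 y1 x2 y2 : measurable (square x1 y1 (s / 2) `|` square x2 y2 (s / 2)).
  by apply: measurableU; exact: measurable_square.
have mS x1 y1 := measurable_square x1 y1 (s / 2).
apply: (le_trans (lower_integral_setU area (mU _ _ _ _) (mU _ _ _ _) d3 (g0' _))).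
exact: leeD (lower_integral_setU area (mS _ _) (mS _ _) d1 (g0' _))
            (lower_integral_setU area (mS _ _) (mS _ _) d2 (g0' _)).
Qed.

Definition npoints_in (f : R[i] -> R[i]) (E : set (R * R)) (w : R[i]) : \bar R :=
  counting [set z | unit_disc z /\ E (Re z, Im z) /\ f z = w].

Lemma npoints_in_setU f (E F : set (R * R)) w : E `&` F = set0 ->
  (npoints_in f E w + npoints_in f F w <= npoints_in f (E `|` F) w)%E.
Proof.
move=> EF; rewrite /npoints_in.
apply: (le_trans (counting_setU_ge _ _)).
  by rewrite -subset0 => z [[_ [Ez _]] [_ [Fz _]]]; have : (E `&` F) (Re z, Im z) by []; rewrite EF.
by rewrite le_eqVlt; apply/orP; left; apply/eqP; congr counting; apply/seteqP; split => z /=; tauto.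
Qed.

Definition cpx (p : R * R) : R[i] := p.1 +i* p.2.

Lemma integral_npoints_in_setU f (B E F : set (R * R)) : E `&` F = set0 ->
  (\int[area]_(q in B) npoints_in f E (cpx q) + \int[area]_(q in B) npoints_in f F (cpx q)
   <= \int[area]_(q in B) npoints_in f (E `|` F) (cpx q))%E.
Proof.
move=> EF; apply: le_trans (lower_integralD _ _ _) _.
- by move=> q _; exact: counting_ge0.
- by move=> q _; exact: counting_ge0.
apply: le_lower_integral => q _; last exact: npoints_in_setU.
by rewrite adde_ge0//; exact: counting_ge0.
Qed.

Lemma integral_npoints_in_split f (B : set (R * R)) x y s :
  ((\int[area]_(q in B) npoints_in f (square x y (s / 2)) (cpx q) +
    \int[area]_(q in B) npoints_in f (square (x + s / 2) y (s / 2)) (cpx q)) +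
   (\int[area]_(q in B) npoints_in f (square x (y + s / 2) (s / 2)) (cpx q) +
    \int[area]_(q in B) npoints_in f (square (x + s / 2) (y + s / 2) (s / 2)) (cpx q))
   <= \int[area]_(q in B) npoints_in f (square x y s) (cpx q))%E.
Proof.
have [d1 d2 d3] := square_splitI x y s.
rewrite [in leRHS]square_split.
apply: le_trans (integral_npoints_in_setU _ _ d3).
by apply: leeD; exact: integral_npoints_in_setU.
Qed.

End area.

(** * A quantitative open mapping property *)

Section image_square.
Context {R : realType}.
Implicit Types x y s : R.

Lemma normc_cpxB_continuous (f : R[i] -> R[i]) w (p : R * R) :
  cderivable f (cpx p) ->
  {for p, continuous (fun q : R * R => normc (f (cpx q) - w))}.
Proof.
move=> fp; apply/cvgrPdist_lt => e e0.
have [d d0 fd] := cderivable_continuous fp e0.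
exists (ball p.1 (d / 2), ball p.2 (d / 2)).
  by split; apply: nbhsx_ballx; rewrite divr_gt0.
move=> q [/= q1 q2]; rewrite distrC.
apply: le_lt_trans (ler_dist_normc _ _) _.
rewrite (_ : _ - _ - _ = f (cpx q) - f (cpx p)); last by ring.
apply: fd.
apply: le_lt_trans (ler_normcReIm _) _.
move: q1 q2; rewrite /ball /= => q1 q2.
by rewrite (splitr d) ltrD// distrC.
Qed.

(** A small step in the direction [- (f z - w) / f' z] of Newton's method
    multiplies [f z - w] by [1 - tau] up to an error of half the gain. *)
Lemma modulus_decrease (f : R[i] -> R[i]) (z w : R[i]) (r : R) :
  cderivable f z -> cderiv f z != 0 -> f z != w -> 0 < r ->
  exists2 h, normc h < r & normc (f (z + h) - w) < normc (f z - w).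
Proof.
move=> fz e0 fzw r0; set e := cderiv f z in e0 *.
have ne := normc_gt0 e0; pose v := f z - w.
have nv : 0 < normc v by apply: normc_gt0; rewrite subr_eq0.
have [d d0 fd] := cderiv_approx fz (divr_gt0 ne (ltr0Sn R 1)).
pose k := normc v / normc e; have k0 : 0 < k by rewrite divr_gt0.
(* The step has length [tau k], which stays below both [r] and [d]. *)
pose tau := Num.min (1 / 2) (Num.min r d / (2 * k)).
have rd0 : 0 < Num.min r d by rewrite lt_min r0.
have tau0 : 0 < tau by rewrite lt_min divr_gt0//= divr_gt0// mulr_gt0.
have tau1 : tau <= 1 / 2 by rewrite ge_min lexx.
have tauk : tau * k < Num.min r d.
  apply: (@le_lt_trans _ _ (Num.min r d / (2 * k) * k)).
    by rewrite ler_wpM2r ?(ltW k0)// /tau ge_min lexx orbT.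
  rewrite (_ : _ / _ * _ = Num.min r d / 2); last by field; rewrite gt_eqF.
  by rewrite ltr_pdivrMr// ltr_pMr// ltr1n.
have nh : normc (- tau%:C * (v / e)) = tau * k.
  by rewrite normcM normc_opp normc_realC gtr0_norm// normcM normcV.
exists (- tau%:C * (v / e)).
  by rewrite nh (lt_le_trans tauk)// ge_min lexx.
have := fd (- tau%:C * (v / e)); rewrite nh => /(_ (lt_le_trans tauk _)).
rewrite ge_min lexx orbT => /(_ isT).
set D := _ - _ - _ => HD.
have -> : f (z + - tau%:C * (v / e)) - w = (1 - tau)%:C * v + D.
  by rewrite /D /v rmorphB rmorph1 -/e; field; exact: e0.
apply: le_lt_trans (ler_normcD _ _) _.
rewrite normcM normc_realC ger0_norm; last by lra.
rewrite -/v; apply: (@le_lt_trans _ _ ((1 - tau) * normc v + tau * normc v / 2)).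
  rewrite lerD2l; apply: le_trans HD _; rewrite le_eqVlt; apply/orP; left; apply/eqP.
  by rewrite /k; field; rewrite gt_eqF.
by nra.
Qed.

(** Let [|f - w|] attain its minimum over the closed square at [z]. Since [f]
    is close to an affine map of slope [d], the value at the centre is smaller
    than all the values on the boundary, so [z] is interior; as [f' z] does not
    vanish, [modulus_decrease] forces the minimum to be zero. *)
Lemma image_square (f : R[i] -> R[i]) (d : R[i]) x y s :
  0 < s ->
  let zc := (x + s / 2) +i* (y + s / 2) in
  (forall z, x <= Re z <= x + s -> y <= Im z <= y + s ->
     [/\ cderivable f z, cderiv f z != 0 &
         normc (f z - f zc - d * (z - zc)) <= normc d * s / 4]) ->
  forall w, normc (w - f zc) < normc d * s / 8 ->
  exists2 z, f z = w & (x < Re z < x + s) && (y < Im z < y + s).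
Proof.
move=> s0 zc Hf w wd.
pose K := `[x, x + s] `*` `[y, y + s] : set (R * R).
have KP p : K p -> (x <= p.1 <= x + s) /\ (y <= p.2 <= y + s).
  by rewrite /K /= !in_itv /=.
pose phi (p : R * R) := normc (f (cpx p) - w).
have cK : compact K by apply: compact_setX; exact: segment_compact.
have xs : x + s / 2 <= x + s by lra.
have Kc : K (x + s / 2, y + s / 2).
  by rewrite /K /= !in_itv /=; split; apply/andP; split; lra.
have cphi : {within K, continuous phi}.
  apply: continuous_in_subspaceT => p /set_mem /KP[p1 p2].
  apply: normc_cpxB_continuous.
  by have [] := Hf (cpx p) p1 p2.
have [[a b] /set_mem /KP /= [ax yb] phimin] :=
  compact_EVT_min (ex_intro _ _ Kc) cK cphi.
have [fz ez app] := Hf (cpx (a, b)) ax yb.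
have lt_c : phi (a, b) < normc d * s / 8.
  apply: le_lt_trans (phimin _ (mem_set Kc)) _.
  by rewrite /phi -normc_opp opprB.
(* The error of the affine approximation is at most a quarter of [|d| s], and
   the values of [f] at [(a, b)] and at the centre lie within an eighth of it
   from [w]. *)
have near_c : normc (d * (cpx (a, b) - zc)) < normc d * (s / 2).
  rewrite (_ : d * _ = - (f (cpx (a, b)) - f zc - d * (cpx (a, b) - zc))
     + (f (cpx (a, b)) - w) + (w - f zc)); last by ring.
  apply: le_lt_trans (ler_normcD _ _) _.
  apply: (@le_lt_trans _ _ (normc d * s / 4 + phi (a, b) + normc (w - f zc))).
    rewrite lerD2r; apply: le_trans (ler_normcD _ _) _.
    by rewrite lerD2r normc_opp.
  by move: lt_c wd; set N := normc d * s => *; rewrite mulrA -/N; lra.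
have d0 : 0 < normc d.
  move: near_c; rewrite normcM => h.
  by have := le_lt_trans (mulr_ge0 (normc_ge0 _) (normc_ge0 _)) h; rewrite pmulr_lgt0 ?divr_gt0.
move: near_c; rewrite normcM ltr_pM2l// => near_c.
have /andP[a1 a2] : x < a < x + s.
  have := le_lt_trans (ler_normRe _) near_c; rewrite /= ltr_norml => /andP[h1 h2].
  by apply/andP; split; lra.
have /andP[b1 b2] : y < b < y + s.
  have := le_lt_trans (ler_normIm _) near_c; rewrite /= ltr_norml => /andP[h1 h2].
  by apply/andP; split; lra.
exists (cpx (a, b)); last by rewrite /= a1 a2 b1 b2.
apply/eqP/negP => /negP fw.
pose r := Num.min (Num.min (a - x) (x + s - a)) (Num.min (b - y) (y + s - b)).
have r0 : 0 < r by rewrite !lt_min !subr_gt0 a1 a2 b1 b2.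
have [h hr] := modulus_decrease fz ez fw r0.
apply/negP; rewrite -leNgt.
have := phimin (a + Re h, b + Im h); rewrite /phi.
have -> : cpx (a + Re h, b + Im h) = cpx (a, b) + h by case: (h).
apply; apply/mem_set; rewrite /K /= !in_itv /=.
have := le_lt_trans (ler_normRe h) hr; have := le_lt_trans (ler_normIm h) hr.
rewrite /r !lt_min !ltr_norml.
move=> /andP[/andP[/andP[? ?] /andP[? ?]] /andP[/andP[? ?] /andP[? ?]]].
move=> /andP[/andP[/andP[? ?] /andP[? ?]] /andP[/andP[? ?] /andP[? ?]]].
by split; apply/andP; split; lra.
Qed.

End image_square.

(** * The area inequality on small squares *)

Section area_inequality.
Context {R : realType}.
Implicit Types (x y s r M : R) (f : R[i] -> R[i]).

(** The step from four quarters to their union in the bisection below. *)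
Lemma leeD4_affine (a1 a2 a3 a4 N1 N2 N3 N4 N : \bar R) (C e : R) : 0 <= C ->
  (0 <= N1)%E -> (0 <= N2)%E -> (0 <= N3)%E -> (0 <= N4)%E ->
  (a1 <= C%:E * N1 + e%:E)%E -> (a2 <= C%:E * N2 + e%:E)%E ->
  (a3 <= C%:E * N3 + e%:E)%E -> (a4 <= C%:E * N4 + e%:E)%E ->
  ((N1 + N2) + (N3 + N4) <= N)%E ->
  ((a1 + a2) + (a3 + a4) <= C%:E * N + (4 * e)%:E)%E.
Proof.
move=> C0 N10 N20 N30 N40 h1 h2 h3 h4 hN.
apply: le_trans (leeD (leeD h1 h2) (leeD h3 h4)) _.
have E (X Y : \bar R) (u v : R) : (0 <= X)%E -> (0 <= Y)%E ->
    (C%:E * X + u%:E + (C%:E * Y + v%:E) = C%:E * (X + Y) + (u + v)%:E)%E.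
  by move=> X0 Y0; rewrite addeACA -ge0_muleDr// EFinD.
rewrite !E ?adde_ge0// (_ : e + e + (e + e) = 4 * e); last by ring.
by rewrite leeD2r// lee_wpmul2l.
Qed.

Lemma normc_closed_square x y s (z1 z2 : R[i]) :
  x <= Re z1 <= x + s -> y <= Im z1 <= y + s ->
  x <= Re z2 <= x + s -> y <= Im z2 <= y + s -> normc (z1 - z2) <= 2 * s.
Proof.
move=> ha1 hb1 ha2 hb2; apply: le_trans (ler_normcReIm _) _.
move: ha1 hb1 ha2 hb2; case: z1 z2 => [a1 b1] [a2 b2] /= ha1 hb1 ha2 hb2.
have : `|a1 - a2| <= s by rewrite ler_norml; apply/andP; split; lra.
have : `|b1 - b2| <= s by rewrite ler_norml; apply/andP; split; lra.
lra.
Qed.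

Lemma integral_square_le (g : R * R -> \bar R) (k x y s : R) : 0 < s ->
  (forall p, square x y s p -> 0%:E <= g p <= k%:E)%E ->
  (\int[area]_(p in square x y s) g p <= (k * s ^+ 2)%:E)%E.
Proof.
move=> s0 gk; apply: (@le_trans _ _ (\int[area]_(p in square x y s) (cst k%:E p))%E).
  by apply: le_lower_integral => p /gk /andP[].
rewrite integral_cst; last exact: measurable_square.
by rewrite [X in (_ * X)%E](area_square _ _ s0) -EFinM.
Qed.

Lemma integral_ge_square (B : set (R * R)) (g : R * R -> \bar R) (x y s : R) : 0 < s ->
  (forall p, 0%:E <= g p)%E -> square x y s `<=` B -> (forall p, square x y s p -> 1%:E <= g p)%E ->
  ((s ^+ 2)%:E <= \int[area]_(p in B) g p)%E.
Proof.
move=> s0 g0 TB g1; apply: (le_trans _ (lower_integral_subset area TB (fun p _ => g0 p))).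
apply: (@le_trans _ _ (\int[area]_(p in square x y s) (cst 1%:E p))%E).
  rewrite integral_cst; last exact: measurable_square.
  by rewrite mul1e [leRHS](area_square _ _ s0).
apply: le_lower_integral => p sp; [by rewrite lee_fin | exact: g1].
Qed.

Definition origin_disc r : set (R * R) := [set p | normc (cpx p) < r].

(** The Jacobian determinant of [f], seen as a map of the plane. *)
Definition energy f (p : R * R) : \bar R := (normc (cderiv f (cpx p)) ^+ 2)%:E.

(** If [|a + i b| > r], small squares near the point miss the disc, and if
    [f'] vanishes there, the integrand is at most [eps] near it. Otherwise let
    [e] be the derivative at the point. On a small square [Q] of side [s] one
    has [|f'| <= 2 |e|], so the left side is at most [4 |e|^2 s^2], while
    [image_square] provides a square of side [|e| s / 16] all of whose points
    have a preimage in [Q]. The constant is the quotient [(2 * 16)^2] of these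
    two bounds. *)
Lemma area_inequality_small_square f (r M eps : R) : r < 1 -> 0 < eps ->
  analytic (@unit_disc R) f -> analytic (@unit_disc R) (cderiv f) ->
  (forall z, normc z <= r -> normc (f z) <= M) ->
  forall a b, exists2 d, 0 < d & forall x y s, 0 < s < d ->
    x <= a <= x + s -> y <= b <= y + s ->
  (\int[area]_(p in square x y s)
     (energy f \_ (origin_disc r)) p
   <= (32 ^+ 2)%:E * \int[area]_(q in square (- (M + 1)) (- (M + 1)) (2 * (M + 1)))
        npoints_in f (square x y s) (cpx q) + (eps * s ^+ 2)%:E)%E.
Proof.
move=> r1 eps0 fan f'an fM a b; set g := _ \_ _; set zs := a +i* b.
have g0 p : (0 <= g p)%E by apply: erestrict_ge0 => q _; rewrite /energy lee_fin sqr_ge0.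
have N0 E : (0 <= \int[area]_(q in square (- (M + 1)) (- (M + 1)) (2 * (M + 1)))
        npoints_in f E (cpx q))%E by apply: integral_ge0 => q _; exact: counting_ge0.
have gle k p : 0 <= k -> normc (cderiv f (cpx p)) <= k -> (g p <= (k ^+ 2)%:E)%E.
  move=> k0 h; rewrite /g /patch /energy; case: ifP => _; rewrite lee_fin ?sqr_ge0//.
  by rewrite lerXn2r// nnegrE normc_ge0.
have sqP x y s p : square x y s p -> (x <= p.1 <= x + s) /\ (y <= p.2 <= y + s).
  by rewrite /square /= => /andP[/andP[-> /ltW ->] /andP[-> /ltW ->]].
have [rz|zr] := ltP r (normc zs).
  exists ((normc zs - r) / 2); first by rewrite divr_gt0 ?subr_gt0.
  move=> x y s /andP[s0 sd] xa yb.
  apply: (@le_trans _ _ 0%E); last first.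
    apply: adde_ge0; first by apply: mule_ge0; rewrite ?lee_fin ?sqr_ge0.
    by rewrite lee_fin mulr_ge0 ?sqr_ge0// ltW.
  rewrite le_eqVlt; apply/orP; left; apply/eqP; apply: integral0_eq => p sp.
  rewrite /g /patch ifF//; apply/negbTE/negP => /set_mem pr.
  have {}pr : normc (cpx p) < r := pr.
  have [p1 p2] := sqP _ _ _ _ sp.
  have := @normc_closed_square x y s zs (cpx p) xa yb p1 p2.
  have := ler_normcD (zs - cpx p) (cpx p); rewrite subrK.
  by move: pr sd; rewrite ltr_pdivlMr//; lra.
have z1 : normc zs < 1 := le_lt_trans zr r1.
have [e0|e0] := eqVneq (cderiv f zs) 0.
  have k0 : 0 < Num.min 1 eps by rewrite lt_min ltr01.
  have [d d0 Hd] := cderivable_continuous (f'an _ z1) k0.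
  exists (d / 2); first by rewrite divr_gt0.
  move=> x y s /andP[s0 sd] xa yb.
  apply: (@le_trans _ _ (eps * s ^+ 2)%:E); last first.
    by rewrite leeDr//; apply: mule_ge0; rewrite ?lee_fin ?sqr_ge0.
  apply: integral_square_le => // p /sqP[p1 p2]; rewrite g0 /=.
  have := Hd (cpx p); rewrite e0 subr0 => /(_ _)/ltW Hp.
  apply: (le_trans (gle _ _ (ltW k0) (Hp _))).
    apply: le_lt_trans (@normc_closed_square x y s (cpx p) zs p1 p2 xa yb) _.
    by move: sd; rewrite ltr_pdivlMr//; lra.
  rewrite lee_fin expr2 -[leRHS]mul1r ler_pM// ?(ltW k0)// ge_min lexx// orbT//.
set e := cderiv f zs in e0.
have ne := normc_gt0 e0.
have [d1 d10 H1] := cderivable_continuous (f'an _ z1) (divr_gt0 ne (ltr0Sn R 1)).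
(* The relative error 1/16 enters twice, at a point of the square and at its
   centre, over distances up to [2 s]: this gives the [|e| s / 4] of
   [image_square]. *)
have [d2 d20 H2] := cderiv_approx (fan _ z1) (divr_gt0 ne (ltr0Sn R 15)).
have [d3 d30 H3] := cderivable_continuous (fan _ z1) (divr_gt0 ltr01 (ltr0Sn R 1)).
pose d := Num.min (Num.min d1 d2) (Num.min d3 (1 - normc zs)).
have d0 : 0 < d by rewrite !lt_min d10 d20 d30 subr_gt0.
exists (Num.min (d / 2) (8 / normc e)); first by rewrite lt_min !divr_gt0.
move=> x y s /andP[s0]; rewrite lt_min => /andP[sd se] xa yb.
have near z : x <= Re z <= x + s -> y <= Im z <= y + s ->
   [/\ normc (z - zs) < d1, normc (z - zs) < d2, normc (z - zs) < d3 & normc z < 1].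
  move=> z1' z2'; have : normc (z - zs) < d.
    apply: le_lt_trans (@normc_closed_square x y s z zs z1' z2' xa yb) _.
    by move: sd; rewrite ltr_pdivlMr//; lra.
  rewrite !lt_min => /andP[/andP[-> ->] /andP[-> h]]; split => //.
  have := ler_normcD (z - zs) zs; rewrite subrK.
  by move: h; lra.
have f'near z : x <= Re z <= x + s -> y <= Im z <= y + s ->
    normc (cderiv f z - e) < normc e / 2.
  by move=> h1 h2; apply: H1; have [] := near _ h1 h2.
have app z : x <= Re z <= x + s -> y <= Im z <= y + s ->
    normc (f z - f zs - e * (z - zs)) <= normc e * s / 8.
  move=> h1 h2; have [_ hd2 _ _] := near _ h1 h2.
  have := H2 _ hd2; rewrite (addrC zs) subrK => h; apply: le_trans h _.
  rewrite (_ : normc e * s / 8 = normc e / 16 * (2 * s)); last by field.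
  by rewrite ler_wpM2l ?divr_ge0 ?(ltW ne)//; exact: (@normc_closed_square x y s).
pose zc := (x + s / 2) +i* (y + s / 2).
have zc1 : x <= Re zc <= x + s by rewrite /=; apply/andP; split; lra.
have zc2 : y <= Im zc <= y + s by rewrite /=; apply/andP; split; lra.
(* One half of the margin 1 around the values of [f] is spent on the centre,
   the other half on the side of the image square. *)
have fzc : normc (f zc) < M + 1 / 2.
  have [_ _ /H3 h _] := near _ zc1 zc2.
  have := ler_normcD (f zc - f zs) (f zs); rewrite subrK.
  by have := fM _ zr; lra.
have se' : normc e * s < 8 by move: se; rewrite ltr_pdivlMr// mulrC.
have hN : (((normc e * s / 16) ^+ 2)%:E <=
   \int[area]_(q in square (- (M + 1)) (- (M + 1)) (2 * (M + 1)))
     npoints_in f (square x y s) (cpx q))%E.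
  have Re_fzc := ler_normRe (f zc); have Im_fzc := ler_normIm (f zc).
  apply: (@integral_ge_square _ _ (Re (f zc)) (Im (f zc))).
  - by rewrite divr_gt0// mulr_gt0.
  - by move=> p; exact: counting_ge0.
  - move: Re_fzc Im_fzc; rewrite !ler_norml /square => /andP[? ?] /andP[? ?] [u v] /=.
    move=> /andP[/andP[? ?] /andP[? ?]].
    by apply/andP; split; apply/andP; split; lra.
  move=> [u v]; rewrite /square /= => /andP[/andP[u1 u2] /andP[v1 v2]].
  have [||z fz /andP[/andP[zx1 zx2] /andP[zy1 zy2]]] :=
    @image_square _ f e x y s s0 _ (cpx (u, v)).
  - move=> z h1 h2; have [_ _ _ zD] := near _ h1 h2; split; first exact: fan.
      apply: contraTneq (f'near _ h1 h2) => ->.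
      by rewrite sub0r normc_opp -leNgt ler_pdivrMr// ler_peMr ?normc_ge0// ler1n.
    rewrite -/zc.
    rewrite (_ : _ - _ - _ = (f z - f zs - e * (z - zs)) -
      (f zc - f zs - e * (zc - zs))); last by ring.
    apply: le_trans (ler_normcD _ _) _; rewrite normc_opp.
    by have := app _ h1 h2; have := app _ zc1 zc2; lra.
  - rewrite -/zc; apply: le_lt_trans (ler_normcReIm _) _.
    move: u1 u2 v1 v2; case: (f zc) => fa fb /= u1 u2 v1 v2.
    by rewrite !ger0_norm ?subr_ge0//; lra.
  have hz1 : x <= Re z <= x + s by rewrite !ltW.
  have hz2 : y <= Im z <= y + s by rewrite !ltW.
  apply: (@counting_ge1 _ _ _ z); split; last split => //.
    by have [] := near _ hz1 hz2.
  by rewrite /square /= zx2 zy2 !ltW.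
apply: (@le_trans _ _ ((2 * normc e) ^+ 2 * s ^+ 2)%:E).
  apply: integral_square_le => // p /sqP[p1 p2]; rewrite g0 /=; apply: gle.
    by rewrite mulr_ge0// ltW.
  rewrite -(subrK e (cderiv f (cpx p))); apply: le_trans (ler_normcD _ _) _.
  rewrite mulr_natl mulr2n lerD2r; apply: le_trans (ltW (f'near (cpx p) p1 p2)) _.
  by rewrite ler_pdivrMr// ler_peMr ?normc_ge0// ler1n.
apply: (@le_trans _ _ ((32 ^+ 2)%:E * ((normc e * s / 16) ^+ 2)%:E)%E).
  by rewrite -EFinM lee_fin le_eqVlt; apply/orP; left; apply/eqP; field.
apply: (@le_trans _ _ ((32 ^+ 2)%:E *
  \int[area]_(q in square (- (M + 1)) (- (M + 1)) (2 * (M + 1)))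
    npoints_in f (square x y s) (cpx q))%E).
  by apply: lee_wpmul2l => //; rewrite lee_fin sqr_ge0.
by rewrite leeDl// lee_fin mulr_ge0 ?sqr_ge0// ltW.
Qed.

End area_inequality.

(** * The area inequality and its consequences for discs *)

Section area_growth.
Context {R : realType}.
Implicit Types (x y s r M : R) (f : R[i] -> R[i]).

Lemma measurable_origin_disc r : measurable (origin_disc r : set (R * R)).
Proof.
have [r0|r0] := leP r 0.
  rewrite (_ : origin_disc r = set0)// -subset0 => p.
  by rewrite /origin_disc /= ltNge (le_trans r0)// normc_ge0.
pose g (p : R * R) := p.1 ^+ 2 + p.2 ^+ 2.
have mg : measurable_fun [set: R * R] g.
  by apply: measurable_funD; apply: measurable_funX;
    [exact: measurable_fst | exact: measurable_snd].
rewrite (_ : origin_disc r = [set: R * R] `&` g @^-1` `]-oo, r ^+ 2[).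
  exact: mg.
apply/seteqP; split => p.
  rewrite /origin_disc /= => h; split => //; rewrite in_itv /=.
  by rewrite -(@ltr_sqrt _ (g p)) ?exprn_gt0// sqrtr_sqr gtr0_norm.
move=> [_]; rewrite /= in_itv /= -(@ltr_sqrt _ (g p)) ?exprn_gt0//.
by rewrite sqrtr_sqr gtr0_norm.
Qed.

Lemma origin_disc_subset r r' : r <= r' -> (origin_disc r : set (R * R)) `<=` origin_disc r'.
Proof. by move=> rr' p; rewrite /origin_disc /= => /lt_le_trans; apply. Qed.

(** The inequality with the extra term passes from quarters to squares because
    the left side is subadditive and the right side superadditive, so
    [square_bisection] gives it on the square of side 2 around the origin; then
    [eps] tends to zero. *)
Lemma area_inequality f r M : r < 1 -> 0 <= M ->
  analytic (@unit_disc R) f -> analytic (@unit_disc R) (cderiv f) ->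
  (forall z, normc z <= r -> normc (f z) <= M) ->
  (\int[area]_(p in origin_disc r) energy f p
   <= (32 ^+ 2)%:E * \int[area]_(q in square (- (M + 1)) (- (M + 1)) (2 * (M + 1)))
        npoints f (cpx q))%E.
Proof.
move=> r1 M0 fan f'an fM.
have e0 p : (0 <= energy f p)%E by rewrite /energy lee_fin sqr_ge0.
set B := square _ _ (2 * _); set g := energy f \_ (origin_disc r).
have g0 p : (0 <= g p)%E by apply: erestrict_ge0.
pose N E := (\int[area]_(q in B) npoints_in f E (cpx q))%E.
have N0 E : (0 <= N E)%E by apply: integral_ge0 => q _; exact: counting_ge0.
have key eps : 0 < eps -> forall x y s, 0 < s ->
    (\int[area]_(p in square x y s) g p
      <= (32 ^+ 2)%:E * N (square x y s) + (eps * s ^+ 2)%:E)%E.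
  move=> eps0; apply: square_bisection; last exact: (area_inequality_small_square r1).
  move=> x y s s0 h1 h2 h3 h4; apply: le_trans (integral_square_split _ _ _ g0) _.
  rewrite (_ : eps * s ^+ 2 = 4 * (eps * (s / 2) ^+ 2)); last by field.
  apply: leeD4_affine h1 h2 h3 h4 _; rewrite ?sqr_ge0//.
  exact: integral_npoints_in_split.
pose Q : set (R * R) := square (-1) (-1) 2.
have subQ : origin_disc r `<=` Q.
  move=> p pr; have {}pr : normc (cpx p) < 1 := lt_trans pr r1.
  have := le_lt_trans (ler_normRe _) pr; have := le_lt_trans (ler_normIm _) pr.
  rewrite /Q /square /= !ltr_norml => /andP[? ?] /andP[? ?].
  by apply/andP; split; apply/andP; split; lra.
have EQ : (\int[area]_(p in origin_disc r) energy f p = \int[area]_(p in Q) g p)%E.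
  by rewrite -integral_mkcondr setIidr.
apply: (@le_trans _ _ ((32 ^+ 2)%:E * N Q)%E).
  apply/lee_addgt0Pr => e epos; rewrite EQ.
  have -> : e = e / 4 * 2 ^+ 2 by field.
  by apply: key; rewrite ?divr_gt0.
apply: lee_wpmul2l; first by rewrite lee_fin sqr_ge0.
apply: le_lower_integral => q _; first exact: counting_ge0.
by apply: le_counting => z [zD [_ fz]].
Qed.

Lemma Vsup_ge0 f : (0 <= Vsup f)%E.
Proof.
apply: (@le_trans _ _ (area_integral (disc 0 1) (npoints f))).
  by apply: integral_ge0 => q _; exact: counting_ge0.
by apply: ereal_sup_ubound; exists 0.
Qed.

(** Side 1/2 is the basic size because such a square lies in the unit disc
    around its centre; each doubling of the side costs a factor 4. *)
Lemma integral_npoints_square f (k : nat) x y :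
  (\int[area]_(q in square x y (2 ^+ k / 2)) npoints f (cpx q)
    <= (4 ^+ k)%:E * Vsup f)%E.
Proof.
have n0 (q : R * R) : (0 <= npoints f (cpx q))%E by exact: counting_ge0.
elim: k x y => [|k IH] x y.
  rewrite !expr0 mul1e; set zc : R[i] := (x + 1 / 4) +i* (y + 1 / 4).
  apply: (@le_trans _ _ (area_integral (disc zc 1) (npoints f))); last first.
    by apply: ereal_sup_ubound; exists zc.
  apply: lower_integral_subset => [p|q _]; last exact: n0.
  rewrite /square /disc /= => /andP[/andP[? ?] /andP[? ?]].
  apply: le_lt_trans (ler_normcReIm (cpx p - zc)) _; rewrite /=.
  have : `|p.1 - (x + 1 / 4)| <= 1 / 4 by rewrite ler_norml; apply/andP; split; lra.
  have : `|p.2 - (y + 1 / 4)| <= 1 / 4 by rewrite ler_norml; apply/andP; split; lra.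
  by lra.
apply: le_trans (integral_square_split _ _ _ n0) _.
have -> : 2 ^+ k.+1 / 2 / 2 = 2 ^+ k / 2 :> R by rewrite exprS; field.
apply: le_trans (leeD (leeD (IH _ _) (IH _ _)) (leeD (IH _ _) (IH _ _))) _.
have k0 : 0 <= 4 ^+ k :> R by rewrite exprn_ge0.
have V0 := Vsup_ge0 f.
rewrite -!ge0_muleDl ?adde_ge0 ?lee_fin// -!EFinD exprS.
by rewrite (_ : 4 ^+ k + 4 ^+ k + (4 ^+ k + 4 ^+ k) = 4 * 4 ^+ k :> R)//; ring.
Qed.

(** The least power of 2 above [x] works, as its half is below [x]. *)
Lemma dyadic_between x : 1 <= x -> exists2 k : nat, x <= 2 ^+ k & 2 ^+ k <= 2 * x.
Proof.
move=> x1; have x0 : 0 <= x by exact: le_trans x1.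
have ex : exists k : nat, x <= 2 ^+ k.
  exists (Num.bound x); apply: le_trans (ltW (archi_boundP x0)) _.
  by rewrite -natrX ler_nat ltnW// ltn_expl.
exists (ex_minn ex); case: ex_minnP => // -[|k] _ kmin; first by rewrite expr0; lra.
rewrite exprS ler_pM2l//; have [//|xk] := lerP (2 ^+ k) x.
by have := kmin k (ltW xk); rewrite ltnn.
Qed.

Lemma integral_npoints_large_square f M : 1 <= M ->
  (\int[area]_(q in square (- (M + 1)) (- (M + 1)) (2 * (M + 1)))
     npoints f (cpx q) <= (16 ^+ 2 * M ^+ 2)%:E * Vsup f)%E.
Proof.
move=> M1; have [|k k1 k2] := @dyadic_between (8 * M); first by lra.
apply: le_trans (lower_integral_subset _ _ _) _; last first.
- apply: le_trans (integral_npoints_square f k (- (M + 1)) (- (M + 1))) _.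
  apply: (lee_wpmul2r (Vsup_ge0 f)); rewrite lee_fin.
  rewrite (_ : 4 = 2 ^+ 2 :> R); last by ring.
  rewrite -exprM mulnC exprM -exprMn lerXn2r ?nnegrE ?exprn_ge0//; last by lra.
  by rewrite mulr_ge0//; lra.
- by move=> q _; exact: counting_ge0.
move=> p; rewrite /square /= => /andP[/andP[? ?] /andP[? ?]].
by apply/andP; split; apply/andP; split; lra.
Qed.

End area_growth.

(** * Summation over annuli *)

Section shells.
Context {R : realType}.

(** The radius at which the weight equals [2 ^ k]. *)
Definition shell_radius (k : nat) : R := 1 - expR (1 - 2 ^+ k).

Lemma shell_radius_lt1 k : shell_radius k < 1.
Proof. by rewrite /shell_radius ltrBlDr ltrDl expR_gt0. Qed.

Lemma le_shell_radius k l : (k <= l)%N -> shell_radius k <= shell_radius l.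
Proof. by move=> kl; rewrite lerD2l lerN2 ler_expR lerD2l lerN2 ler_eXn2l// ltr1n. Qed.

Lemma le_radial_weight (s t : R) : s <= t -> t < 1 -> radial_weight s <= radial_weight t.
Proof.
move=> st t1; rewrite lerD2l lerN2 ler_ln ?posrE ?subr_gt0//.
  by rewrite lerD2l lerN2.
exact: le_lt_trans t1.
Qed.

Lemma radial_weight_shell_radius k : radial_weight (shell_radius k) = 2 ^+ k.
Proof.
rewrite /radial_weight /shell_radius opprB addrCA subrr addr0.
by rewrite expRK opprB addrC subrK.
Qed.

Lemma bigcup_origin_disc :
  \bigcup_k origin_disc (shell_radius k.+1) = [set p : R * R | unit_disc (p.1 +i* p.2)].
Proof.
apply/seteqP; split => p.
  by move=> [k _ pk]; exact: lt_trans pk (shell_radius_lt1 _).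
move=> p1; have {}p1 : normc (cpx p) < 1 := p1.
exists (Num.bound (radial_weight (normc (cpx p)))) => //=; set n := Num.bound _.
rewrite /origin_disc /= ltNge; apply/negP => pn.
have := le_radial_weight pn p1; rewrite radial_weight_shell_radius; apply/negP; rewrite -ltNge.
have L0 : 0 <= radial_weight (normc (cpx p)).
  by apply: le_trans ler01 (radial_weight_ge1 _); rewrite normc_ge0.
apply: lt_le_trans (archi_boundP L0) _; rewrite -/n -natrX ler_nat.
by apply: leq_trans (ltnW (ltn_expl n.+1 (ltnSn 1))).
Qed.

(** For [k = 0] the lower bound holds on the whole disc, as the weight is at
    least 1. *)
Lemma radial_weight_shell k (p : R * R) : seqD (fun k => origin_disc (shell_radius k.+1)) k p ->
  0 <= normc (cpx p) < 1 /\ 2 ^+ k <= radial_weight (normc (cpx p)).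
Proof.
case: k => [|k].
  move=> h; have p01 : 0 <= normc (cpx p) < 1.
    by rewrite normc_ge0 (lt_trans h (shell_radius_lt1 _)).
  by rewrite expr0; split => //; exact: radial_weight_ge1.
move=> [h nh]; have p1 : normc (cpx p) < 1 := lt_trans h (shell_radius_lt1 _).
split; first by rewrite normc_ge0.
rewrite -radial_weight_shell_radius; apply: le_radial_weight => //.
by rewrite leNgt; exact/negP.
Qed.

Lemma nneseries_geometric_lty (a q : R) (u : nat -> \bar R) :
  0 <= a -> 0 < q < 1 -> (forall k, 0 <= u k)%E ->
  (forall k, u k <= (a * q ^+ k)%:E)%E -> (\sum_(k <oo) u k < +oo)%E.
Proof.
move=> a0 /andP[q0 q1] u0 ua; apply: (@le_lt_trans _ _ (a / (1 - q))%:E); last exact: ltry.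
apply: lime_le; first by apply: is_cvg_nneseries => n _ _; exact: u0.
apply: nearW => n.
apply: (@le_trans _ _ (\sum_(0 <= k < n) (a * q ^+ k)%:E)%E).
  by apply: lee_sum => k _; exact: ua.
by rewrite sumEFin lee_fin; apply: geometric_le_lim => //; rewrite gtr0_norm.
Qed.

End shells.

Theorem theorem5 (R : realType) (A f : R[i] -> R[i])
    (hA : analytic (@unit_disc R) A)
    (hnA : (normL1 A < +oo)%E)
    (hf : analytic (@unit_disc R) f)
    (hode : solves_ode (@unit_disc R) A f)
    (hV : (Vsup f < +oo)%E)
    (beta : R) (hbeta : (normL1 A * (2^-1)%:E < beta%:E)%E) :
  (area_integral (@unit_disc R)
     (fun z => (normc (cderiv f z) ^+ 2 * log_weight z `^ (- beta))%:E) < +oo)%E.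
Proof.
have f'an : analytic (@unit_disc R) (cderiv f) by move=> z /hode[].
have term_ge0 (z : R[i]) : normc z < 1 ->
    0 <= normc (A z) * (1 - normc z ^+ 2) ^+ 2 * log_weight z.
  move=> z1; apply: mulr_ge0.
    by apply: mulr_ge0; [exact: normc_ge0 | exact: sqr_ge0].
  by rewrite log_weight_radial//; apply: le_trans ler01 (radial_weight_ge1 _); rewrite normc_ge0.
have disc0 : normc (0 : R[i]) < 1 by rewrite normc0.
have nA0 : (0 <= normL1 A)%E.
  apply: (@le_trans _ _ (normc (A 0) *
    (1 - normc (0 : R[i]) ^+ 2) ^+ 2 * log_weight (0 : R[i]))%:E).
    by rewrite lee_fin; exact: term_ge0.
  by apply: ereal_sup_ubound; exists 0.
pose alpha := fine (normL1 A).
have nAE : normL1 A = alpha%:E by rewrite fineK// ge0_fin_numE.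
have alpha0 : 0 <= alpha by rewrite fine_ge0.
have alpha_beta : alpha / 2 < beta by move: hbeta; rewrite nAE -EFinM lte_fin.
have HA z : normc z < 1 ->
    normc (A z) * (1 - normc z ^+ 2) ^+ 2 * radial_weight (normc z) <= alpha.
  move=> z1; rewrite -log_weight_radial// -lee_fin -nAE.
  by apply: ereal_sup_ubound; exists z.
(* The midpoint of the interval of those [c] with [alpha < 4 c] and
   [2 c < beta]. *)
pose c := (alpha / 2 + beta) / 4.
have ac : alpha < 4 * c by rewrite /c; lra.
have c0 : 0 < c by rewrite /c; lra.
have cb : 2 * c < beta by rewrite /c; lra.
have [K K0 fK] := ode_growth alpha0 ac HA hf hode.
have V0 := Vsup_ge0 f.
pose v := fine (Vsup f).
have VE : Vsup f = v%:E by rewrite fineK// ge0_fin_numE.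
have v0 : 0 <= v by rewrite fine_ge0.
pose l2 : R := ln 2; have l20 : 0 < l2 by rewrite ln_gt0// ltr1n.
have ln2X k : ln (2 ^+ k) = l2 * k%:R :> R by rewrite lnXn// mulr_natr.
(* A bound for [|f|] up to the outer radius of the annulus, where the weight is
   [2 ^ k.+1]; [K + 1] instead of [K] ensures [M k >= 1]. *)
pose M k := (K + 1) * expR (c * (l2 * k.+1%:R)).
have M1 k : 1 <= M k.
  rewrite -[leLHS]mulr1 ler_pM//; first by rewrite lerDr ltW.
  by rewrite -[leLHS]expR0 ler_expR mulr_ge0 ?(ltW c0)// mulr_ge0// ltW.
have fM k z : normc z <= shell_radius k.+1 -> normc (f z) <= M k.
  move=> zk; have zk1 := shell_radius_lt1 (R := R) k.+1.
  apply: le_trans (fK _ (le_lt_trans zk zk1)) _.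
  apply: ler_pM; rewrite ?expR_ge0 ?(ltW K0)//; first by rewrite lerDl.
  rewrite ler_expR ler_wpM2l ?(ltW c0)// -ln2X ler_ln ?posrE ?exprn_gt0//.
    by rewrite -radial_weight_shell_radius; exact: le_radial_weight.
  by apply: lt_le_trans ltr01 (radial_weight_ge1 _); rewrite normc_ge0 (le_lt_trans zk).
pose S := seqD (fun k => origin_disc (shell_radius (R := R) k.+1)).
have hom : {homo (fun k => origin_disc (shell_radius (R := R) k.+1)) :
    n m / (n <= m)%N >-> (n <= m)%O}.
  by move=> n m nm; apply/subsetPset/origin_disc_subset/le_shell_radius.
have mS k : measurable (S k).
  case: k => [|k]; first exact: measurable_origin_disc.
  by apply: measurableD; exact: measurable_origin_disc.
pose F (p : R * R) : \bar R :=
  (normc (cderiv f (cpx p)) ^+ 2 * log_weight (cpx p) `^ (- beta))%:E.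
have F0 p : (0 <= F p)%E by rewrite lee_fin mulr_ge0 ?sqr_ge0 ?powR_ge0.
have E0 p : (0 <= energy f p)%E by rewrite lee_fin sqr_ge0.
have DE : [set p : R * R | unit_disc (p.1 +i* p.2)] = \bigcup_k S k.
  by rewrite eq_bigcup_seqD bigcup_origin_disc.
rewrite /area_integral DE.
change ((\int[area]_(p in \bigcup_k S k) F p < +oo)%E).
apply: le_lt_trans (lower_integral_bigcup area mS (trivIset_seqD hom) (fun p _ => F0 p)) _.
pose a := 32 ^+ 2 * (16 ^+ 2 * (K + 1) ^+ 2 * expR (2 * (c * l2)) * v).
pose q := expR ((2 * c - beta) * l2).
apply: (@nneseries_geometric_lty _ a q).
- rewrite /a mulr_ge0 ?sqr_ge0// mulr_ge0// mulr_ge0 ?expR_ge0//.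
  by rewrite mulr_ge0 ?sqr_ge0.
- rewrite /q expR_gt0 /= -[ltRHS]expR0 ltr_expR.
  by rewrite pmulr_llt0// subr_lt0.
- by move=> k; apply: integral_ge0 => p _; exact: F0.
move=> k; pose ck := expR (- beta * (l2 * k%:R)).
have FS p : S k p -> (F p <= ck%:E * energy f p)%E.
  move=> /radial_weight_shell[/andP[_ p1] Lk].
  rewrite /F /energy -EFinM lee_fin mulrC ler_wpM2r ?sqr_ge0// log_weight_radial//.
  have L0 : 0 < radial_weight (normc (cpx p)) by apply: lt_le_trans Lk; rewrite exprn_gt0.
  rewrite /powR gt_eqF// ler_expR !mulNr lerN2 ler_wpM2l//; first by lra.
  by rewrite -ln2X ler_ln ?posrE ?exprn_gt0.
apply: le_trans (le_lower_integral area (fun p _ => F0 p) FS) _.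
apply: le_trans (lower_integralZl (f := energy f) area (expR_gt0 _) (mS k) (fun p _ => E0 p)) _.
have sS : S k `<=` origin_disc (shell_radius k.+1).
  by case: (k) => [//|n] p [].
have M0 : 0 <= M k by apply: le_trans (M1 k).
have I1 := lower_integral_subset area sS (fun p _ => E0 p).
have I2 := area_inequality (shell_radius_lt1 k.+1) M0 hf f'an (fM k).
have I3 := integral_npoints_large_square f (M1 k).
have ck0 : (0 <= ck%:E)%E by rewrite lee_fin expR_ge0.
have c32 : (0 <= (32 ^+ 2)%:E :> \bar R)%E by rewrite lee_fin sqr_ge0.
apply: le_trans (lee_wpmul2l ck0 (le_trans I1 (le_trans I2 (lee_wpmul2l c32 I3)))) _.
rewrite VE -!EFinM lee_fin le_eqVlt; apply/orP; left; apply/eqP.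
have -> : q ^+ k = expR ((2 * c - beta) * l2 * k%:R) by rewrite mulrC expRM_natl.
have E1 : ck * M k ^+ 2
    = (K + 1) ^+ 2 * expR (2 * (c * l2)) * expR ((2 * c - beta) * l2 * k%:R).
  rewrite /ck /M exprMn -expRM_natl mulrCA -expRD -mulrA -expRD.
  by congr (_ * expR _); rewrite -natr1; ring.
rewrite /a.
transitivity (32 ^+ 2 * (16 ^+ 2 * v) * (ck * M k ^+ 2)); first by ring.
by rewrite E1; ring.
Qed.
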